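(* Let $\mathcal{K}\subseteq\mathbb{R}^d$ be nonempty, convex and compact, with diameter $D=\max_{x,y\in\mathcal{K}}\|x-y\|$. Assume: (i) $|\tilde F(x;z)|\le B$ for all $x\in\mathcal{K}$, $z\in\mathcal{Z}$; (ii) $\|\nabla\tilde F(x;z)\|\le G_{\tilde F}$ for all $x\in\mathcal{K}$, $z\in\mathcal{Z}$, and $\mathbb{E}_{z\sim p(z;x)}\|\nabla\log p(z;x)\|^4\le G_p^4$ for all $x\in\mathcal{K}$; put $G=\max\{G_{\tilde F},G_p\}$; (iii) $\|\nabla^2\tilde F(x;z)\|\le L_{\tilde F}$ for all $x\in\mathcal{K}$, $z\in\mathcal{Z}$, and $\mathbb{E}_{z\sim p(z;x)}\|\nabla^2\log p(z;x)\|^2\le L_p^2$ for all $x\in\mathcal{K}$ (spectral norms); put $L=\max\{L_{\tilde F},L_p\}$. Let $\bar L=\left(4B^2G^4+16G^4+4L^2+4B^2L^2\right)^{1/2}$. Assume moreover that $F$ is convex on $\mathcal{K}$, and let $x^*$ be a minimizer of $F$ on $\mathcal{K}$. Run the one-sample stochastic Frank-Wolfe method (1-SFW) with the exact Hessian option and the minimization update, for $T\ge 1$ iterations, with $\rho_t=(t-1)^{-1}$ (for $t\ge2$) and $\eta_t=t^{-1}$ (for $t\ge1$). Then $x_{T+1}\in\mathcal{K}$ and $$\mathbb{E}[F(x_{T+1})-F(x^* )]\le\frac{2\sqrt{C}D}{\sqrt T}+\frac{\bar L D^2(1+\ln T)}{2T},$$ where $C=\max\{4(2G+D\bar L)^2,\,256,\,[2D(\bar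 L+L)]^4\}$.
   Context: Problem (non-oblivious stochastic optimization): $F:\mathbb{R}^d\to\mathbb{R}$, $F(x)=\mathbb{E}_{z\sim p(z;x)}[\tilde F(x;z)]$, where $\tilde F:\mathbb{R}^d\times\mathcal{Z}\to\mathbb{R}$ and, for each $x$, $p(\cdot;x)$ is a probability density on $\mathcal{Z}$ which may depend on $x$. Gradients $\nabla$ and Hessians $\nabla^2$ are with respect to $x$; $\|\cdot\|$ is the Euclidean norm for vectors and the spectral norm for matrices. Hessian estimator: $$\tilde\nabla^2F(x;z)=\tilde F(x;z)[\nabla\log p(z;x)][\nabla\log p(z;x)]^\top+\nabla^2\tilde F(x;z)+[\nabla\tilde F(x;z)][\nabla\log p(z;x)]^\top+\tilde F(x;z)\nabla^2\log p(z;x)+[\nabla\log p(z;x)][\nabla\tilde F(x;z)]^\top.$$ Standing assumptions: $F$, $\tilde F(\cdot;z)$ and $\log p(z;\cdot)$ are twice continuously differentiable, all functions are measurable in $z$, and for all $x\in\mathcal{K}$ the estimators are unbiased: $\mathbb{E}_{z\sim p(z;x)}[\nabla\tilde F(x;z)]=\nabla F(x)$ and $\mathbb{E}_{z\sim p(z;x)}[\tilde\nabla^2F(x;z)]=\nabla^2F(x)$. Algorithm 1-SFW (exact Hessian option, minimization update). Input: $\rho_t,\eta_t\in(0,1]$, a deterministic initial point $x_1\in\mathcal{K}$, number of iterations $T$. For $t=1,\dots,T$: - If $t=1$: sample $z_1\sim p(\cdot;x_1)$ and set $d_1=\nabla\tilde F(x_1;z_1)$. - If $t\ge2$: draw $a$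 uniformly from $[0,1]$ independently of the past; set $x_t(a)=ax_t+(1-a)x_{t-1}$; sample (conditionally on the past and $a$) $z_t\sim p(\cdot;x_t(a))$; set $\tilde\Delta_t=\tilde\nabla^2F(x_t(a);z_t)\,(x_t-x_{t-1})$ and $d_t=(1-\rho_t)(d_{t-1}+\tilde\Delta_t)+\rho_t\nabla\tilde F(x_t;z_t)$. - Update: $v_t\in\arg\min_{v\in\mathcal{K}}v^\top d_t$ (measurably selected), $x_{t+1}=x_t+\eta_t(v_t-x_t)$. The expectation is over all randomness of the algorithm. *)

(* Defs.v *)
From HB Require Import structures.
From mathcomp Require Import all_boot all_order all_algebra.
From mathcomp Require Import all_classical all_reals all_analysis.

Set Implicit Arguments.
Unset Strict Implicit.
Unset Printing Implicit Defensive.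

Import Order.TTheory GRing.Theory Num.Theory.
Import numFieldNormedType.Exports.

Local Open Scope classical_set_scope.
Local Open Scope ring_scope.

Section Euclidean.
Context {R : realType}.

Definition dotv n (u v : 'cV[R]_n) : R := (u^T *m v) 0 0.

(* The library norm `|v| on matrices is the sup norm. *)
Definition enorm n (v : 'cV[R]_n) : R := Num.sqrt (dotv v v).

Definition spnorm m n (A : 'M[R]_(m, n)) : R :=
  sup [set enorm (A *m v) | v in [set v : 'cV[R]_n | enorm v <= 1]].

Definition is_diameter n (K : set 'cV[R]_n) (D : R) : Prop :=
  (exists x y, [/\ K x, K y & D = enorm (x - y)]) /\
  (forall x y, K x -> K y -> enorm (x - y) <= D).

Definition grad n (f : 'cV[R]_n -> R) (x : 'cV[R]_n) : 'cV[R]_n :=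
  \col_i 'D_(delta_mx i 0) f x.

Definition hess n (f : 'cV[R]_n -> R) (x : 'cV[R]_n) : 'M[R]_n :=
  \matrix_(i, j) 'D_(delta_mx j 0) (fun y => grad f y i 0) x.

Definition twice_cont_diff n (f : 'cV[R]_n -> R) : Prop :=
  [/\ forall x, differentiable f x,
      forall i x, differentiable (fun y => grad f y i 0) x
    & forall i j, continuous (fun x => hess f x i j)].

End Euclidean.

Section Problem.
Context {R : realType} {n : nat} {dZ : measure_display} {Z : measurableType dZ}.
Variables (mu : {measure set Z -> \bar R}).
Variables (F : 'cV[R]_n -> R) (Ft : 'cV[R]_n -> Z -> R) (p : Z -> 'cV[R]_n -> R).

(* E_(z ~ p(.; x)) [g z]; extended-real valued, so that an equation
   Ep x g = r%:E with r : R also says that the expectation is finite. *)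
Definition Ep (x : 'cV[R]_n) (g : Z -> R) : \bar R :=
  (\int[mu]_z (g z * p z x)%:E)%E.

Definition grad_Ft (x : 'cV[R]_n) (z : Z) : 'cV[R]_n := grad (Ft ^~ z) x.
Definition hess_Ft (x : 'cV[R]_n) (z : Z) : 'M[R]_n := hess (Ft ^~ z) x.
Definition logp (z : Z) (x : 'cV[R]_n) : R := ln (p z x).
Definition grad_logp (x : 'cV[R]_n) (z : Z) : 'cV[R]_n := grad (logp z) x.
Definition hess_logp (x : 'cV[R]_n) (z : Z) : 'M[R]_n := hess (logp z) x.

Definition hess_est (x : 'cV[R]_n) (z : Z) : 'M[R]_n :=
  Ft x z *: (grad_logp x z *m (grad_logp x z)^T)
  + hess_Ft x z
  + grad_Ft x z *m (grad_logp x z)^T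
  + Ft x z *: hess_logp x z
  + grad_logp x z *m (grad_Ft x z)^T.

(* Positivity of p is part of log p(z; .) being a (C^2) real function on the
   whole space; it must be explicit because ln vanishes on nonpositive reals. *)
Record nonoblivious_problem (K : set 'cV[R]_n) : Prop := NonobliviousProblem {
  density_gt0 : forall z x, 0 < p z x ;
  density_measurable : forall x, measurable_fun setT (p ^~ x) ;
  density_int1 : forall x, (\int[mu]_z (p z x)%:E = 1)%E ;
  objectiveE : forall x, Ep x (Ft x) = (F x)%:E ;
  F_C2 : twice_cont_diff F ;
  Ft_C2 : forall z, twice_cont_diff (Ft ^~ z) ;
  logp_C2 : forall z, twice_cont_diff (logp z) ;
  Ft_measurable : forall x, measurable_fun setT (Ft x) ;
  grad_Ft_measurable : forall x i, measurable_fun setT (fun z => grad_Ft x z i 0) ;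
  hess_Ft_measurable :
    forall x i j, measurable_fun setT (fun z => hess_Ft x z i j) ;
  grad_logp_measurable :
    forall x i, measurable_fun setT (fun z => grad_logp x z i 0) ;
  hess_logp_measurable :
    forall x i j, measurable_fun setT (fun z => hess_logp x z i j) ;
  grad_unbiased : forall x, K x -> forall i,
    Ep x (fun z => grad_Ft x z i 0) = (grad F x i 0)%:E ;
  hess_unbiased : forall x, K x -> forall i j,
    Ep x (fun z => hess_est x z i j) = (hess F x i j)%:E
}.

Section OneSFW.
Context {dO : measure_display} {Omega : measurableType dO}.
Variable P : probability Omega R.
Variables (a : nat -> Omega -> R) (z : nat -> Omega -> Z).
Variables (x dir v : nat -> Omega -> 'cV[R]_n).

Definition sfw_events (s : nat) : set (set Omega) :=
  preimage_set_system setT (z s) measurable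
  `|` [set E | (2 <= s)%N /\ preimage_set_system setT (a s) measurable E]
  `|` \bigcup_(i : 'I_n)
        preimage_set_system setT (fun w => v s w i 0) measurable.

(* The sigma-algebra of the past before round t, generated by z_s, v_s and
   (if s >= 2) a_s for 1 <= s < t; the x_s and dir_s are functions of these.
   Since v_s is included, the selection of v_s may use external randomness. *)
Definition sfw_past (t : nat) : set (set Omega) :=
  <<s \bigcup_(s in [set s | (1 <= s < t)%N]) sfw_events s >>.

Definition sfw_past_a (t : nat) : set (set Omega) :=
  <<s sfw_past t `|` preimage_set_system setT (a t) measurable >>.

Definition sfw_mid (t : nat) (w : Omega) : 'cV[R]_n :=
  a t w *: x t w + (1 - a t w) *: x t.-1 w.

(* The processes a, z, x, dir (the d_t of the algorithm) and v form a run of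
   T rounds of 1-SFW with exact Hessian; a_t is only used for t >= 2. *)
Record one_sfw_run (K : set 'cV[R]_n) (x1 : 'cV[R]_n) (T : nat)
    (rho eta : nat -> R) : Prop := OneSFWRun {
  sfw_z_measurable :
    forall t, (1 <= t <= T)%N -> measurable_fun setT (z t) ;
  sfw_a_measurable :
    forall t, (2 <= t <= T)%N -> measurable_fun setT (a t) ;
  sfw_v_measurable :
    forall t i, (1 <= t <= T)%N -> measurable_fun setT (fun w => v t w i 0) ;
  sfw_z1_law : forall A, measurable A ->
    P (z 1%N @^-1` A) = (\int[mu]_(y in A) (p y x1)%:E)%E ;
  sfw_a_uniform : forall t, (2 <= t <= T)%N -> forall A, measurable A ->
    P (a t @^-1` A) = uniform_prob (@ltr01 R) A ;
  sfw_a_indep : forall t, (2 <= t <= T)%N ->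
    forall E A, sfw_past t E -> measurable A ->
    P (E `&` a t @^-1` A) = (P E * P (a t @^-1` A))%E ;
  (* conditionally on the past and a_t, z_t has density p(.; x_t(a_t)) *)
  sfw_z_law : forall t, (2 <= t <= T)%N ->
    forall E A, sfw_past_a t E -> measurable A ->
    P (E `&` z t @^-1` A) =
      (\int[P]_(w in E) \int[mu]_(y in A) (p y (sfw_mid t w))%:E)%E ;
  sfw_x_init : forall w, x 1%N w = x1 ;
  sfw_dir_init : forall w, dir 1%N w = grad_Ft x1 (z 1%N w) ;
  sfw_dir_step : forall t, (2 <= t <= T)%N -> forall w,
    dir t w =
      (1 - rho t) *: (dir t.-1 w
                      + hess_est (sfw_mid t w) (z t w) *m (x t w - x t.-1 w))
      + rho t *: grad_Ft (x t w) (z t w) ;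
  sfw_v_argmin : forall t, (1 <= t <= T)%N -> forall w,
    K (v t w) /\ (forall u, K u -> dotv (v t w) (dir t w) <= dotv u (dir t w)) ;
  sfw_x_step : forall t, (1 <= t <= T)%N -> forall w,
    x t.+1 w = x t w + eta t *: (v t w - x t w)
}.

End OneSFW.
End Problem.

(* Main.v *)
Require Import Defs.
From HB Require Import structures.
From mathcomp Require Import all_boot all_order all_algebra.
From mathcomp Require Import all_classical all_reals all_analysis.
From mathcomp Require Import measurable_realfun.
From mathcomp Require Import ring lra.

Set Implicit Arguments.
Unset Strict Implicit.
Unset Printing Implicit Defensive.

Import Order.TTheory GRing.Theory Num.Theory.
Import numFieldNormedType.Exports.

Local Open Scope classical_set_scope.
Local Open Scope ring_scope.

(** The Frank-Wolfe step with a surrogate direction d_t in place of the gradient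
    loses, compared with the exact method, at most D |e_t| per unit of step size,
    where e_t = grad F(x_t) - d_t; with step size 1/t this gives
      t gap_(t+1) <= (t - 1) gap_t + D |e_t| + Lbar D^2 / (2 t)
    ([gap_step]). The theorem follows by summation from E|e_t|^2 <= C / t
    ([mean_square_error_le], [expected_gap]).

    For the error, d_t transports d_(t-1) along the segment from x_(t-1) to x_t
    by a Hessian estimate at a uniform point m of the segment. The estimate is
    unbiased at m, and the mean of hess F over the segment, applied to the
    displacement, is the increment of grad F ([integral_hess_line]), so this
    transport adds only noise, of mean square at most Lbar^2 |x_t - x_(t-1)|^2.
    The latter holds since the four groups of terms of the estimator have
    second moments bounded by the assumptions ([hess_est_sqr]). The fresh
    gradient sample is evaluated at x_t but drawn from the density at m; it is
    therefore biased, by at most (Lbar + L) |x_t - x_(t-1)|, which is of the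
    order 1/t of the step itself. Together ([mean_error_step])
      E|e_t|^2 <= (1 - rho)^2 E|e_(t-1)|^2 + O(rho^2),  rho = 1 / (t - 1),
    and C is large enough for C / t to be preserved ([rate_recursion]).

    Jensen's inequality applied to the same second moments bounds hess F by Lbar
    and grad F by G on K, which gives the smoothness of F used in both
    recursions.

    On the probabilistic side, all expectations are of nonnegative functions and
    the conditional laws enter through one disintegration formula
    ([ge0_integral_disintegration]), obtained from the equality of two measures
    on rectangles. It is used twice in each round: for z_t given the past and
    a_t, and for a_t given the past. The joint measurability that it requires
    comes from continuity in x and measurability in z
    ([measurable_caratheodory]). *)

(** * Euclidean vectors and the spectral norm *)

Section EuclideanTheory.
Context {R : realType}.

Lemma dotvE n (u v : 'cV[R]_n) : dotv u v = \sum_i u i 0 * v i 0.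
Proof. by rewrite /dotv mxE; apply: eq_bigr => i _; rewrite mxE. Qed.

Lemma dotvC n (u v : 'cV[R]_n) : dotv u v = dotv v u.
Proof. by rewrite !dotvE; apply: eq_bigr => i _; rewrite mulrC. Qed.

Lemma dotvDr n (u v w : 'cV[R]_n) : dotv u (v + w) = dotv u v + dotv u w.
Proof. by rewrite /dotv mulmxDr mxE. Qed.

Lemma dotvZr n (k : R) (u v : 'cV[R]_n) : dotv u (k *: v) = k * dotv u v.
Proof. by rewrite /dotv -scalemxAr mxE. Qed.

Lemma dotvNr n (u v : 'cV[R]_n) : dotv u (- v) = - dotv u v.
Proof. by rewrite -scaleN1r dotvZr mulN1r. Qed.

Lemma dotvBr n (u v w : 'cV[R]_n) : dotv u (v - w) = dotv u v - dotv u w.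
Proof. by rewrite dotvDr dotvNr. Qed.

Lemma dotvDl n (u v w : 'cV[R]_n) : dotv (v + w) u = dotv v u + dotv w u.
Proof. by rewrite dotvC dotvDr !(dotvC u). Qed.

Lemma dotvZl n (k : R) (u v : 'cV[R]_n) : dotv (k *: u) v = k * dotv u v.
Proof. by rewrite dotvC dotvZr dotvC. Qed.

Lemma dotvNl n (u v : 'cV[R]_n) : dotv (- u) v = - dotv u v.
Proof. by rewrite dotvC dotvNr dotvC. Qed.

Lemma dotvBl n (u v w : 'cV[R]_n) : dotv (v - w) u = dotv v u - dotv w u.
Proof. by rewrite dotvDl dotvNl. Qed.

Lemma dotv0r n (u : 'cV[R]_n) : dotv u 0 = 0.
Proof. by rewrite -(scale0r 0) dotvZr mul0r. Qed.

Definition dotvE_linear := (dotvDr, dotvDl, dotvNr, dotvNl, dotvZr, dotvZl).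

Lemma dotvv_ge0 n (u : 'cV[R]_n) : 0 <= dotv u u.
Proof. by rewrite dotvE; apply: sumr_ge0 => i _; rewrite -expr2 sqr_ge0. Qed.

Lemma dotv_delta n (u : 'cV[R]_n) i : dotv (delta_mx i 0) u = u i 0.
Proof.
rewrite dotvE (bigD1 i) //= mxE !eqxx mul1r big1 ?addr0 // => j /negPf ji.
by rewrite mxE ji mul0r.
Qed.

Lemma enorm_ge0 n (u : 'cV[R]_n) : 0 <= enorm u.
Proof. exact: sqrtr_ge0. Qed.

Lemma enorm_sqr n (u : 'cV[R]_n) : enorm u ^+ 2 = dotv u u.
Proof. by rewrite sqr_sqrtr // dotvv_ge0. Qed.

Lemma enorm0 n : enorm (0 : 'cV[R]_n) = 0.
Proof. by rewrite /enorm dotv0r sqrtr0. Qed.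

Lemma enormZ n (k : R) (u : 'cV[R]_n) : enorm (k *: u) = `|k| * enorm u.
Proof.
by rewrite /enorm dotvZl dotvZr mulrA -expr2 sqrtrM ?sqr_ge0 // sqrtr_sqr.
Qed.

Lemma enormN n (u : 'cV[R]_n) : enorm (- u) = enorm u.
Proof. by rewrite -scaleN1r enormZ normrN1 mul1r. Qed.

Lemma enorm_distC n (u v : 'cV[R]_n) : enorm (u - v) = enorm (v - u).
Proof. by rewrite -opprB enormN. Qed.

Lemma enorm_eq0 n (u : 'cV[R]_n) : enorm u = 0 -> u = 0.
Proof.
move=> u0; apply/matrixP => i j; rewrite (ord1 j) mxE.
have : dotv u u = 0 by rewrite -enorm_sqr u0 expr0n.
rewrite dotvE => /psumr_eq0P s0; apply/eqP; rewrite -sqrf_eq0 expr2 s0 // => k _.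
by rewrite -expr2 sqr_ge0.
Qed.

(** From |u - v|^2 >= 0. It replaces products by squares before means are
    taken, where a product of norms would call for Hoelder's inequality. *)
Lemma dotv_young n (u v : 'cV[R]_n) : 2 * dotv u v <= dotv u u + dotv v v.
Proof.
have := dotvv_ge0 (u - v); rewrite dotvBl !dotvBr (dotvC v u); lra.
Qed.

Lemma cauchy_schwarz n (u v : 'cV[R]_n) : dotv u v <= enorm u * enorm v.
Proof.
have [u0|u0] := eqVneq (enorm u) 0.
  by rewrite u0 mul0r (enorm_eq0 u0) dotvC dotv0r.
have [v0|v0] := eqVneq (enorm v) 0.
  by rewrite v0 mulr0 (enorm_eq0 v0) dotv0r.
have up : 0 < enorm u by rewrite lt_neqAle eq_sym u0 enorm_ge0.
have vp : 0 < enorm v by rewrite lt_neqAle eq_sym v0 enorm_ge0.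
have := dotv_young (enorm v *: u) (enorm u *: v).
rewrite !dotvE_linear -!enorm_sqr => h.
have k0 : 0 < 2 * (enorm u * enorm v) by rewrite !mulr_gt0.
rewrite -(ler_pM2l k0); nra.
Qed.

Lemma cauchy_schwarz_abs n (u v : 'cV[R]_n) : `|dotv u v| <= enorm u * enorm v.
Proof.
rewrite ler_norml cauchy_schwarz andbT lerNl -dotvNl.
by rewrite (le_trans (cauchy_schwarz _ _)) ?enormN.
Qed.

Lemma enormD n (u v : 'cV[R]_n) : enorm (u + v) <= enorm u + enorm v.
Proof.
rewrite -(@ler_pXn2r _ 2) ?nnegrE ?enorm_ge0 ?addr_ge0 ?enorm_ge0 //.
rewrite sqrrD !enorm_sqr dotvDl !dotvDr (dotvC v u) -mulr_natl.
have := cauchy_schwarz u v; lra.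
Qed.

Lemma le_enorm n (u : 'cV[R]_n) (k : R) : 0 <= k -> dotv u u <= k ^+ 2 -> enorm u <= k.
Proof.
by move=> k0 h; rewrite -(@ler_pXn2r _ 2) ?nnegrE ?enorm_ge0 // enorm_sqr.
Qed.

Lemma mulmx_outer n (u w v : 'cV[R]_n) : (u *m w^T) *m v = dotv w v *: u.
Proof.
apply/matrixP => i j; rewrite (ord1 j) -mulmxA [LHS]mxE big_ord1 !mxE /dotv mxE.
by rewrite mulrC.
Qed.

Lemma dotv_mulmx n (u v : 'cV[R]_n) (A : 'M[R]_n) :
  dotv u (A *m v) = \sum_i \sum_j u i 0 * v j 0 * A i j.
Proof.
rewrite dotvE; apply: eq_bigr => i _; rewrite mxE big_distrr.
by apply: eq_bigr => j _ /=; rewrite -mulrA (mulrC (v j 0)).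
Qed.

(** Rows are bounded one at a time by Cauchy-Schwarz, so the supremum that
    defines the spectral norm is over a bounded set; without this, [sup] would
    be a default value. *)
Lemma has_ubound_spnorm n (A : 'M[R]_n) :
  has_ubound [set enorm (A *m v) | v in [set v : 'cV[R]_n | enorm v <= 1]].
Proof.
exists (\sum_i enorm (row i A)^T) => _ [w /= w1 <-].
have row_le i : `|(A *m w) i 0| <= enorm (row i A)^T.
  have -> : (A *m w) i 0 = dotv (row i A)^T w.
    by rewrite /dotv trmxK -row_mul [RHS]mxE.
  rewrite (le_trans (cauchy_schwarz_abs _ _)) //.
  by rewrite -[leRHS]mulr1 ler_wpM2l ?enorm_ge0.
apply: le_enorm; first by apply: sumr_ge0 => i _; exact: enorm_ge0.
rewrite dotvE expr2 big_distrl /=; apply: ler_sum => i _.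
rewrite -expr2 -real_normK ?num_real // expr2 ler_pM ?normr_ge0 //.
rewrite (le_trans (row_le i)) // (bigD1 i) //= lerDl.
by apply: sumr_ge0 => k _; exact: enorm_ge0.
Qed.

Lemma spnorm_ge0 n (A : 'M[R]_n) : 0 <= spnorm A.
Proof.
apply: ub_le_sup; first exact: has_ubound_spnorm.
by exists 0 => /=; rewrite ?mulmx0 enorm0.
Qed.

Lemma enorm_mulmx n (A : 'M[R]_n) (v : 'cV[R]_n) :
  enorm (A *m v) <= spnorm A * enorm v.
Proof.
have [v0|v0] := eqVneq (enorm v) 0.
  by rewrite v0 mulr0 (enorm_eq0 v0) mulmx0 enorm0.
have vp : 0 < enorm v by rewrite lt_neqAle eq_sym v0 enorm_ge0.
rewrite -ler_pdivrMr // mulrC.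
have -> : (enorm v)^-1 * enorm (A *m v) = enorm (A *m ((enorm v)^-1 *: v)).
  by rewrite -scalemxAr enormZ ger0_norm ?invr_ge0 ?enorm_ge0.
apply: ub_le_sup; [exact: has_ubound_spnorm|exists ((enorm v)^-1 *: v) => //=].
by rewrite enormZ ger0_norm ?invr_ge0 ?enorm_ge0 // mulVf.
Qed.

(** Cauchy-Schwarz with four terms, the two mixed ones being grouped. The mixed
    term is linearized by G^2 g^2 <= (G^4 + g^4) / 2, so that only the fourth
    moment of the score is used. *)
Lemma enorm_sqr_score_hessian n (f B G L : R) (g gF v : 'cV[R]_n) (A H : 'M[R]_n) :
  `|f| <= B -> enorm gF <= G -> spnorm A <= L ->
  enorm ((f *: (g *m g^T) + A + gF *m g^T + f *: H + g *m gF^T) *m v) ^+ 2 <=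
  (8 * G ^+ 4 + 4 * L ^+ 2) * enorm v ^+ 2
  + (4 * B ^+ 2 + 8) * enorm v ^+ 2 * enorm g ^+ 4
  + 4 * B ^+ 2 * enorm (H *m v) ^+ 2.
Proof.
move=> hf hgF hA; rewrite !mulmxDl -!scalemxAl !mulmx_outer.
have b0 : 0 <= B := le_trans (normr_ge0 _) hf.
have h1 : enorm (f *: (dotv g v *: g)) <= B * (enorm g ^+ 2 * enorm v).
  rewrite !enormZ ler_pM ?mulr_ge0 ?enorm_ge0 //.
  by rewrite expr2 mulrAC ler_wpM2r ?enorm_ge0 // cauchy_schwarz_abs.
have h2 : enorm (A *m v) <= L * enorm v.
  by rewrite (le_trans (enorm_mulmx _ _)) // ler_wpM2r ?enorm_ge0.
have h3 : enorm (dotv g v *: gF) <= G * (enorm g * enorm v).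
  rewrite enormZ mulrC; apply: ler_pM; rewrite ?enorm_ge0 ?normr_ge0 //.
  exact: cauchy_schwarz_abs.
have h4 : enorm (f *: (H *m v)) <= B * enorm (H *m v).
  by rewrite enormZ ler_wpM2r ?enorm_ge0.
have h5 : enorm (dotv gF v *: g) <= G * (enorm g * enorm v).
  rewrite enormZ mulrA [leRHS]mulrAC ler_wpM2r ?enorm_ge0 //.
  by rewrite (le_trans (cauchy_schwarz_abs _ _)) // ler_wpM2r ?enorm_ge0.
move: h1 h2 h3 h4 h5; set t1 := f *: _; set t2 := _ *m v; set t3 := _ *: gF.
set t4 := f *: _; set t5 := _ *: g; move=> h1 h2 h3 h4 h5.
set gam := enorm g in h1 h3 h5 *; set nu := enorm v in h1 h2 h3 h5 *.
set l := enorm (H *m v) in h4 *.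
have tri := (enormD (t1 + t2 + t3 + t4) t5, enormD (t1 + t2 + t3) t4,
             enormD (t1 + t2) t3, enormD t1 t2).
set e := enorm _.
have e0 : 0 <= e := enorm_ge0 _.
set s1 := B * _ in h1; set s2 := L * _ in h2; set s3 := G * _ in h3 h5; set s4 := B * l in h4.
have he : e <= s1 + s2 + 2 * s3 + s4 by move: tri => [[[]]]; rewrite /e; lra.
have : e ^+ 2 <= (s1 + s2 + 2 * s3 + s4) ^+ 2.
  by rewrite ler_pXn2r // nnegrE (le_trans e0 he).
have cs : (s1 + s2 + 2 * s3 + s4) ^+ 2 <= 4 * (s1 ^+ 2 + s2 ^+ 2 + (2 * s3) ^+ 2 + s4 ^+ 2).
  have := sqr_ge0 (s1 - s2); have := sqr_ge0 (s1 - 2 * s3); have := sqr_ge0 (s1 - s4).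
  have := sqr_ge0 (s2 - 2 * s3); have := sqr_ge0 (s2 - s4); have := sqr_ge0 (2 * s3 - s4).
  lra.
have mix : 4 * (2 * s3) ^+ 2 <= 8 * (G ^+ 4 + gam ^+ 4) * nu ^+ 2.
  have := mulr_ge0 (sqr_ge0 (G ^+ 2 - gam ^+ 2)) (sqr_ge0 nu).
  rewrite /s3; lra.
move=> h; apply: le_trans h (le_trans cs _).
by move: mix; rewrite /s1 /s2 /s4; lra.
Qed.

(** The error after a step splits as r + U + V, where r is the damped old error,
    U = (1 - rho) (c - h) is the error of the correction h and V = rho (f - gx)
    that of the fresh sample gx. In the cross term of r and V the vectors fm and
    gm are inserted: gm has mean fm, and the two remaining differences are
    bounded. *)
Lemma enorm_sqr_error_step n (f f' d fm gx gm h c r q : 'cV[R]_n) (rho G a : R) :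
  0 <= rho -> c = f - f' -> r = (1 - rho) *: (f' - d) ->
  q = (2 * (1 - rho)) *: r + (4 * (1 - rho) ^+ 2) *: c ->
  enorm (f - gx) <= 2 * G -> enorm (f - fm) + enorm (gm - gx) <= a ->
  enorm (f - ((1 - rho) *: (d + h) + rho *: gx)) ^+ 2 <=
  enorm r ^+ 2 + 2 * (1 - rho) * dotv r c + 2 * rho * (enorm r * a)
  + 2 * rho * dotv r fm - 2 * rho * dotv r gm - dotv q h
  + 2 * (1 - rho) ^+ 2 * dotv c c + 2 * (1 - rho) ^+ 2 * enorm h ^+ 2
  + 8 * rho ^+ 2 * G ^+ 2.
Proof.
move=> rho0 cE rE qE hV ha; set w := 1 - rho in rE qE *.
pose U := w *: (c - h); pose V := rho *: (f - gx).
have -> : f - (w *: (d + h) + rho *: gx) = r + (U + V).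
  rewrite rE /U /V cE; apply/matrixP => i j; rewrite !mxE /w; ring.
have rV : dotv r (f - gx) <= enorm r * a + dotv r fm - dotv r gm.
  have -> : f - gx = (f - fm) + (gm - gx) + (fm - gm).
    by apply/matrixP => i j; rewrite !mxE; ring.
  have := ler_wpM2l (enorm_ge0 r) ha.
  have := cauchy_schwarz r (f - fm); have := cauchy_schwarz r (gm - gx).
  rewrite !(dotvDr, dotvNr); lra.
have VV : dotv V V <= rho ^+ 2 * (2 * G) ^+ 2.
  rewrite /V dotvZl dotvZr mulrA -expr2 ler_wpM2l ?sqr_ge0 // -enorm_sqr.
  by rewrite ler_pXn2r ?nnegrE ?enorm_ge0 // (le_trans (enorm_ge0 _) hV).
have UU : dotv U U = w ^+ 2 * (dotv c c - 2 * dotv c h + dotv h h).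
  by rewrite /U dotvZl dotvZr dotvBl !dotvBr (dotvC h c); ring.
have yUV := dotv_young U V.
have rV2 := ler_wpM2l (mulr_ge0 (ler0n _ 2) rho0) rV.
rewrite !enorm_sqr dotvDl !dotvDr !dotvDl (dotvC U r) (dotvC V r) (dotvC V U).
have -> : dotv r U = w * (dotv r c - dotv r h) by rewrite /U dotvZr dotvBr.
have -> : dotv r V = rho * dotv r (f - gx) by rewrite /V dotvZr.
have -> : dotv q h = 2 * w * dotv r h + 4 * w ^+ 2 * dotv c h.
  by rewrite qE dotvDl !dotvZl.
rewrite UU in yUV *; lra.
Qed.

(** The arithmetic that ends the proof of [mean_error_step], over plain reals:
    there the atoms are derivatives, on which deciding linear arithmetic is
    slow. *)
Lemma substitute_bound (k hh P Q S y l u1 u2 u3 u4 u5 u6 rho b1 b2 : R) :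
  0 <= k -> hh <= P + Q * y + S * l ->
  u1 + u2 + u3 + u4 - 2 * rho * b1 - b2 + u5 + k * hh + u6 <=
  u1 + u2 + u3 + u4 + u5 + k * P + u6 + - (2 * rho) * b1 + -1 * b2
  + k * Q * y + k * S * l.
Proof. by move=> k0 /(ler_wpM2l k0); lra. Qed.

End EuclideanTheory.

(** * Calculus along segments *)

Section CalculusOnLines.
Context {R : realType} {n : nat}.
Implicit Types (f : 'cV[R]_n -> R) (x y u d : 'cV[R]_n).

Lemma derive_grad f x d : differentiable f x -> 'D_d f x = dotv (grad f x) d.
Proof.
move=> df; rewrite deriveE // {1}(_ : d = \sum_i d i 0 *: delta_mx i 0); last first.
  apply/matrixP => i j; rewrite (ord1 j) summxE (bigD1 i) //= !mxE !eqxx mulr1.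
  by rewrite big1 ?addr0 // => k /negPf ki; rewrite !mxE eq_sym ki mulr0.
rewrite linear_sum dotvE; apply: eq_bigr => i _.
by rewrite linearZ /= -deriveE // mxE mulrC.
Qed.

Lemma is_derive_line f x d (s : R) : differentiable f (x + s *: d) ->
  is_derive s 1 (fun r : R => f (x + r *: d)) (dotv (grad f (x + s *: d)) d).
Proof.
move=> df; rewrite -derive_grad //.
have E : (fun h : R => h^-1 *: (((fun r : R => f (x + r *: d)) \o shift s) (h *: 1)
            - f (x + s *: d)))
  = (fun h : R => h^-1 *: ((f \o shift (x + s *: d)) (h *: d) - f (x + s *: d))).
  apply/funext => h /=; congr (_ *: (f _ - _)).
  by rewrite -[_ *: 1]/(h * 1) mulr1 scalerDl addrCA.
have dv : derivable f (x + s *: d) d by exact: diff_derivable.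
by split; rewrite /derivable /derive E.
Qed.

Lemma is_derive_grad_line f x d u (s : R) : twice_cont_diff f ->
  is_derive s 1 (fun r : R => dotv u (grad f (x + r *: d)))
    (dotv u (hess f (x + s *: d) *m d)).
Proof.
move=> [_ dg _].
have -> : (fun r : R => dotv u (grad f (x + r *: d))) =
    \sum_i (fun r : R => u i 0 *: grad f (x + r *: d) i 0).
  by apply/funext => r; rewrite fct_sumE dotvE.
have -> : dotv u (hess f (x + s *: d) *m d) =
    \sum_i u i 0 *: dotv (grad (fun y => grad f y i 0) (x + s *: d)) d.
  rewrite dotvE; apply: eq_bigr => i _; congr (_ * _).
  by rewrite dotvE mxE; apply: eq_bigr => j _; rewrite !mxE.
by apply: is_derive_sum => i; apply: is_deriveZ; apply: is_derive_line.
Qed.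

Lemma continuous_sum (X : topologicalType) (I : Type) (r : seq I) (f : I -> X -> R) :
  (forall i, continuous (f i)) -> continuous (fun t => \sum_(i <- r) f i t).
Proof.
move=> cf; elim: r => [|i r IH] t.
  by under eq_fun do rewrite big_nil; exact: cst_continuous.
under eq_fun do rewrite big_cons.
by apply: continuousD; [exact: cf|exact: IH].
Qed.

Lemma continuous_line x d : continuous (fun r : R => x + r *: d).
Proof.
move=> r; apply: cvgD; first exact: cvg_cst.
by apply: cvgZr_tmp; exact: cvg_id.
Qed.

Lemma is_derive_continuous (g g' : R -> R) :
  (forall s : R, is_derive s (1 : R) g (g' s)) -> continuous g.
Proof.
by move=> dg s; apply: differentiable_continuous; apply/derivable1_diffP.
Qed.

Lemma MVT01 (g g' : R -> R) : (forall s : R, is_derive s (1 : R) g (g' s)) ->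
  exists2 s, 0 <= s <= 1 & g 1 - g 0 = g' s.
Proof.
move=> dg; have [|s] := @MVT R g g' 0 1 ltr01 (fun s _ => dg s).
  exact/continuous_subspaceT/(is_derive_continuous dg).
rewrite in_itv /= => /andP[s0 s1] ->; exists s; first by rewrite !ltW.
by rewrite subr0 mulr1.
Qed.

(** The mean value theorem for the scalar function obtained by pairing the
    gradient with its own increment; this gives the optimal constant without a
    vector-valued mean value inequality. *)
Lemma grad_lipschitz f x y (k : R) : twice_cont_diff f -> 0 <= k ->
  (forall s d, 0 <= s <= 1 ->
     enorm (hess f (x + s *: (y - x)) *m d) <= k * enorm d) ->
  enorm (grad f y - grad f x) <= k * enorm (y - x).
Proof.
move=> f2 k0 hk; set u := grad f y - grad f x.
have [s s01] := MVT01 (is_derive_grad_line x (y - x) u ^~ f2).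
rewrite scale1r scale0r addr0 subrKC -dotvBr -enorm_sqr => E.
have [u0|u0] := eqVneq (enorm u) 0; first by rewrite u0 mulr_ge0 ?enorm_ge0.
have up : 0 < enorm u by rewrite lt_neqAle eq_sym u0 enorm_ge0.
rewrite -(ler_pM2l up) -expr2 E (le_trans (cauchy_schwarz _ _)) //.
by rewrite ler_wpM2l ?enorm_ge0 // hk.
Qed.

(** The quadratic upper model minus f has a nonnegative derivative along the
    segment. *)
Lemma descent_lemma f x y (k : R) : twice_cont_diff f ->
  (forall s, 0 <= s <= 1 -> enorm (grad f (x + s *: (y - x)) - grad f x)
     <= k * enorm (s *: (y - x))) ->
  f y <= f x + dotv (grad f x) (y - x) + k / 2 * enorm (y - x) ^+ 2.
Proof.
move=> [df _ _] hk; set d := y - x in hk *.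
pose g s := f (x + s *: d) - s * dotv (grad f x) d
            - s ^+ 2 * (k / 2 * enorm d ^+ 2).
pose g' s := dotv (grad f (x + s *: d)) d - dotv (grad f x) d
             - 2 * s * (k / 2 * enorm d ^+ 2).
have dg (s : R) : is_derive s (1 : R) g (g' s).
  apply: is_deriveB; last first.
    have -> : (fun r : R => r ^+ 2 * (k / 2 * enorm d ^+ 2)) =
      (k / 2 * enorm d ^+ 2) *: (id ^+ 2 : R -> R).
      by apply/funext => r /=; rewrite mulrC.
    by apply: is_derive_eq; rewrite /GRing.scale /= mulr1 mulrC -mulr_natl expr1.
  apply: is_deriveB; first exact: is_derive_line.
  have -> : (fun r : R => r * dotv (grad f x) d) = dotv (grad f x) d *: id.
    by apply/funext => r /=; rewrite mulrC.
  by apply: is_derive_eq; rewrite /GRing.scale /= mulr1.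
have [s s01] := MVT01 dg.
have /andP[s0 _] := s01.
rewrite /g scale1r scale0r addr0 subrKC => E.
suff : g' s <= 0 by rewrite -E; lra.
rewrite /g' -dotvBl; have := le_trans (cauchy_schwarz _ d) (ler_wpM2r (enorm_ge0 d) (hk s s01)).
rewrite enormZ ger0_norm //; lra.
Qed.

(** By convexity the difference quotients of f at x towards y are at most
    f y - f x, and they converge to the directional derivative. *)
Lemma convex_grad_le f (K : set 'cV[R]_n) x y : differentiable f x ->
  convex_function K f -> K x -> K y -> f x + dotv (grad f x) (y - x) <= f y.
Proof.
move=> df cf Kx Ky; rewrite -lerBrDl.
have dx : differentiable f (x + (0 : R) *: (y - x)) by rewrite scale0r addr0.
have [dl] := is_derive_line dx.
rewrite scale0r addr0 => E; rewrite leNgt; apply/negP => lt_slope.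
set c := dotv _ _ in E lt_slope; pose e := c - (f y - f x).
have e0 : 0 < e by rewrite subr_gt0.
move: dl => /cvg_ex[l] dl; have lc : l = c by rewrite -E; apply/esym/cvg_lim.
move: dl; rewrite lc => /cvgrPdist_lt /(_ e e0) /nbhs_ballP [r /= r0 hr].
pose h := Num.min (r / 2) 1.
have h0 : 0 < h by rewrite lt_min ltr01 divr_gt0.
have h1 : h <= 1 by rewrite ge_min lexx orbT.
have hlt : h < r by rewrite gt_min ltr_pdivrMr // ltr_pMr // ltr1n.
have := hr h; rewrite /ball /= sub0r normrN gtr0_norm // => /(_ hlt) /(_ (lt0r_neq0 h0)).
rewrite -[h *: 1]/(h * 1) mulr1 addr0 scale0r addr0 => {}hr.
have := cf (Itv01 (ltW h0) h1) y x; rewrite !inE => /(_ Ky Kx).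
rewrite convRE /= /unstable.onem.
have -> : conv (Itv01 (ltW h0) h1) (y : convex_lmodType 'cV[R]_n) x = x + h *: (y - x).
  rewrite /conv /= /unstable.onem scalerBl scale1r scalerBr.
  by rewrite addrCA addrA addrC addrA.
move=> fh; move: hr; rewrite ltr_norml => /andP[_]; apply/negP; rewrite -leNgt.
rewrite /e lerB // -[_ *: _]/(_ * _) mulrC ler_pdivrMr //; nra.
Qed.

(** The fundamental theorem of calculus for the gradient along a segment: the
    mean Hessian increment over a uniform point of the segment is exactly the
    increment of the gradient. The constant k turns the integrand into the
    affine bound to which the formula is applied, so that it is integrated in
    one piece. *)
Lemma integral_hess_line f x d u (k : R) : twice_cont_diff f ->
  (\int[lebesgue_measure]_(s in `[0%R, 1%R]) (k - dotv u (hess f (x + s *: d) *m d))%:E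
   = (k - dotv u (grad f (x + d) - grad f x))%:E)%E.
Proof.
move=> f2.
pose g s := s * k - dotv u (grad f (x + s *: d)).
have dg (s : R) : is_derive s (1 : R) g (k - dotv u (hess f (x + s *: d) *m d)).
  apply: is_deriveB; last exact: is_derive_grad_line.
  rewrite (_ : (fun r : R => r * k) = k *: id); last first.
    by apply/funext => r /=; rewrite mulrC.
  by apply: is_derive_eq; rewrite /GRing.scale /= mulr1.
rewrite (continuous_FTC2 ltr01 (F := g)) //.
- by rewrite /g scale1r scale0r addr0 dotvBr -EFinB; congr EFin; ring.
- apply: continuous_subspaceT => s; apply: cvgB; first exact: cvg_cst.
  under eq_fun do rewrite dotv_mulmx; rewrite dotv_mulmx.
  move: s; have [_ _ hc] := f2.
  apply: continuous_sum => i; apply: continuous_sum => j s; apply: cvgM.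
    exact: cvg_cst.
  apply: (@continuous_comp _ _ _ (fun r : R => x + r *: d) (fun y => hess f y i j)).
    exact: continuous_line.
  exact: hc.
- have cg := is_derive_continuous dg.
  split; first by move=> s _; have [] := dg s.
  + by apply: cvg_at_right_filter; exact: cg.
  + by apply: cvg_at_left_filter; exact: cg.
- by move=> s _; rewrite derive1E; have [] := dg s.
Qed.

End CalculusOnLines.

(** * Caratheodory functions and measurable vectors *)

Section Caratheodory.
Context {R : realType} {n : nat}.

(** Rounding every coordinate down to a multiple of 1 / (k + 1), indexed by the
    integer numerators. *)
Definition grid_index (k : nat) (x : 'cV[R]_n) : 'cV[int]_n :=
  \col_i Num.floor (k.+1%:R * x i 0).

Definition grid_point (k : nat) (m : 'cV[int]_n) : 'cV[R]_n :=
  \col_i ((m i 0)%:~R / k.+1%:R).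

Lemma grid_cvg (x : 'cV[R]_n) : grid_point k (grid_index k x) @[k --> \oo] --> x.
Proof.
move=> A /nbhs_ballP [e /= e0 eA].
have := @cvg_harmonic R => /cvgrPdist_lt /(_ e e0).
apply: filterS => k; rewrite sub0r normrN ger0_norm; last by rewrite invr_ge0.
move=> ke; apply: eA; split=> [//|i j]; rewrite (ord1 j) /ball /= !mxE.
have k0 : 0 < k.+1%:R :> R by rewrite ltr0n.
set y := x i 0; have /andP[h1 h2] := floor_itv (k.+1%:R * y : R).
rewrite -[y in y - _](mulKf (lt0r_neq0 k0)) mulrC -mulrBl normrM.
rewrite [X in _ * X]gtr0_norm ?invr_gt0 //; apply: le_lt_trans ke.
rewrite /harmonic -[leRHS]mul1r ler_wpM2r ?invr_ge0 //.
rewrite ger0_norm ?subr_ge0 //; move: h2; rewrite intrD; lra.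
Qed.

Lemma measurable_grid_index d (T : measurableType d) (X : T -> 'cV[R]_n) k m :
  (forall i, measurable_fun setT (fun t => X t i 0)) ->
  measurable [set t | grid_index k (X t) = m].
Proof.
move=> mX.
have -> : [set t | grid_index k (X t) = m] =
  \bigcap_(i in [set: 'I_n])
     ((fun t => k.+1%:R * X t i 0) @^-1` [set` `[(m i 0)%:~R, (m i 0 + 1)%:~R[ : interval R]).
  apply/seteqP; split => t /=.
    by move=> <- i _ /=; rewrite mxE in_itv /=; exact: floor_itv.
  move=> h; apply/matrixP => i j; rewrite (ord1 j) mxE.
  by apply: Num.Theory.floor_def; have := h i I; rewrite /= in_itv.
apply: fin_bigcap_measurable; first exact: finite_finset.
move=> i _; rewrite -[X in measurable X]setTI.
have : measurable_fun setT (fun t => k.+1%:R * X t i 0).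
  by apply: measurable_funM => //; exact: measurable_cst.
by apply => //; exact: measurable_itv.
Qed.

(** A Caratheodory function, continuous in its first argument and measurable in
    the second, may be composed with measurable maps. The first argument is
    rounded to a countable grid, where measurability is a countable case
    distinction, and continuity handles the limit. *)
Lemma measurable_caratheodory d (T : measurableType d) d' (Y : measurableType d')
    (f : 'cV[R]_n -> Y -> R) (X : T -> 'cV[R]_n) (V : T -> Y) :
  (forall y, continuous (f ^~ y)) -> (forall x, measurable_fun setT (f x)) ->
  (forall i, measurable_fun setT (fun t => X t i 0)) -> measurable_fun setT V ->
  measurable_fun setT (fun t => f (X t) (V t)).
Proof.
move=> cf mf mX mV.
apply: (@measurable_fun_cvg _ _ _ _ (fun k t => f (grid_point k (grid_index k (X t))) (V t))).
  move=> k _ A mA; rewrite setTI.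
  have -> : (fun t => f (grid_point k (grid_index k (X t))) (V t)) @^-1` A =
    \bigcup_(m in [set: 'cV[int]_n])
      ([set t | grid_index k (X t) = m] `&` (f (grid_point k m) \o V) @^-1` A).
    apply/seteqP; split => t /=; first by exists (grid_index k (X t)).
    by move=> [m _ [<-]].
  apply: countable_bigcupT_measurable => [|m]; first exact: countableP.
  apply: measurableI; first exact: measurable_grid_index.
  rewrite -[X in measurable X]setTI.
  have mfV : measurable_fun setT (f (grid_point k m) \o V) by exact: measurableT_comp.
  exact: mfV.
move=> t _.
exact: (cvg_comp (fun k => grid_point k (grid_index k (X t))) (f ^~ (V t))
  (@grid_cvg (X t)) (cf (V t) (X t))).
Qed.

End Caratheodory.

Section MeasurableVectors.
Context {R : realType} {n : nat} d (T : measurableType d).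
Implicit Types f g : T -> 'cV[R]_n.

(** Measurability for the product sigma-algebra on vectors, stated
    coordinatewise. *)
Definition measurable_vec f : Prop := forall i, measurable_fun setT (fun t => f t i 0).

Lemma measurable_vec_cst (u : 'cV[R]_n) : measurable_vec (fun=> u).
Proof. by move=> i; exact: measurable_cst. Qed.

Lemma measurable_vecD f g : measurable_vec f -> measurable_vec g ->
  measurable_vec (fun t => f t + g t).
Proof.
move=> mf mg i; rewrite (_ : (fun t => _) = (fun t => f t i 0 + g t i 0)).
  exact: measurable_funD.
by apply/funext => t; rewrite mxE.
Qed.

Lemma measurable_vecZ (k : T -> R) f : measurable_fun setT k -> measurable_vec f ->
  measurable_vec (fun t => k t *: f t).
Proof.
move=> mk mf i; rewrite (_ : (fun t => _) = (fun t => k t * f t i 0)).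
  exact: measurable_funM.
by apply/funext => t; rewrite mxE.
Qed.

Lemma measurable_vecB f g : measurable_vec f -> measurable_vec g ->
  measurable_vec (fun t => f t - g t).
Proof.
move=> mf mg i; rewrite (_ : (fun t => _) = (fun t => f t i 0 - g t i 0)).
  exact: measurable_funB.
by apply/funext => t; rewrite !mxE.
Qed.

Lemma measurable_vec_mulmx (A : T -> 'M[R]_n) f :
  (forall i j, measurable_fun setT (fun t => A t i j)) -> measurable_vec f ->
  measurable_vec (fun t => A t *m f t).
Proof.
move=> mA mf i; rewrite (_ : (fun t => _) = (fun t => \sum_j A t i j * f t j 0)).
  by apply: measurable_sum => j; exact: measurable_funM.
by apply/funext => t; rewrite mxE.
Qed.

Lemma measurable_dotv f g : measurable_vec f -> measurable_vec g ->
  measurable_fun setT (fun t => dotv (f t) (g t)).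
Proof.
move=> mf mg; rewrite (_ : (fun t => _) = (fun t => \sum_i f t i 0 * g t i 0)).
  by apply: measurable_sum => i; exact: measurable_funM.
by apply/funext => t; rewrite dotvE.
Qed.

Lemma measurable_enorm f : measurable_vec f -> measurable_fun setT (fun t => enorm (f t)).
Proof.
move=> mf; apply: (@measurableT_comp _ _ _ _ _ _ (@Num.sqrt R)).
  exact: (continuous_measurable_fun (@sqrt_continuous R)).
exact: measurable_dotv.
Qed.

End MeasurableVectors.

Lemma measurable_vec_comp (R : realType) n d1 d2 (T1 : measurableType d1)
    (T2 : measurableType d2) (f : T2 -> 'cV[R]_n) (phi : T1 -> T2) :
  measurable_fun setT phi -> measurable_vec f -> measurable_vec (f \o phi).
Proof. by move=> mphi mf i; exact: (measurableT_comp (mf i) mphi). Qed.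

(** * Densities and disintegration *)

Section Density.
Context d (T : measurableType d) {R : realType}.
Variables (nu : {measure set T -> \bar R}) (q : T -> R).
Hypotheses (mq : measurable_fun setT q) (q0 : forall t, 0 <= q t).
Local Open Scope ereal_scope.

Definition density_measure of measurable_fun setT q & (forall t, (0 <= q t)%R) :=
  fun A : set T => \int[nu]_(t in A) (q t)%:E.

Let mqE : measurable_fun setT (EFin \o q).
Proof. exact/measurable_EFinP. Qed.

Local Notation dens := (density_measure mq q0).

Let density0 : dens set0 = 0.
Proof. by rewrite /density_measure integral_set0. Qed.

Let density_ge0 A : 0 <= dens A.
Proof. by apply: integral_ge0 => t _; rewrite lee_fin. Qed.

Let density_sigma_additive : semi_sigma_additive dens.
Proof.
move=> /= A mA tA mUA; rewrite /density_measure; apply: cvg_toP.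
  apply: ereal_nondecreasing_is_cvgn => m n mn.
  by apply: lee_sum_nneg_natr => // k _ _; apply: integral_ge0 => t _; rewrite lee_fin.
rewrite ge0_integral_bigcup //=; first exact: measurable_funTS.
by move=> t _; rewrite lee_fin.
Qed.

HB.instance Definition _ := isMeasure.Build _ _ _ dens
  density0 density_ge0 density_sigma_additive.

Let integral_density_indic A : measurable A ->
  \int[dens]_t (\1_A t)%:E = \int[nu]_t ((\1_A t)%:E * (q t)%:E).
Proof.
move=> mA; rewrite integral_indic //= /density_measure setIT integral_mkcond /=.
apply: eq_integral => t _; rewrite patchE indicE.
by case: ifPn => At; rewrite ?mul1e ?mul0e.
Qed.

Import HBNNSimple.

Let integral_density_nnsfun (f : {nnsfun T >-> R}) :
  \int[dens]_t (f t)%:E = \int[nu]_t ((f t)%:E * (q t)%:E).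
Proof.
under [LHS]eq_integral do rewrite fimfunE -fsumEFin//.
rewrite [LHS]ge0_integral_fsum//; last 2 first.
  - by move=> r; exact/measurable_EFinP/measurableT_comp.
  - by move=> n x _; rewrite EFinM nnfun_muleindic_ge0.
under [RHS]eq_integral.
  move=> x xD; rewrite fimfunE -fsumEFin// ge0_mule_fsuml; last first.
    by move=> r; rewrite EFinM nnfun_muleindic_ge0.
  over.
rewrite [RHS]ge0_integral_fsum//; last 2 first.
  - move=> r; apply: emeasurable_funM => //.
    by apply/measurable_EFinP; do 2 apply/measurableT_comp => //.
  - move=> n x _; apply: mule_ge0; last by rewrite lee_fin.
    by rewrite EFinM nnfun_muleindic_ge0.
apply: eq_fsbigr => r _.
under [RHS]eq_integral do rewrite EFinM -muleA.
have [r0|r0] := leP 0%R r; last first.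
  rewrite preimage_nnfun0 //.
  by rewrite !integral0_eq // => t _; rewrite indic0 ?mul0e ?mule0 ?mulr0.
rewrite integralZl_indic_nnsfun //= integral_density_indic // ge0_integralZl //.
- by apply: emeasurable_funM => //; exact/measurable_EFinP.
- by move=> t _; rewrite mule_ge0 // lee_fin.
Qed.

Lemma ge0_integral_density (f : T -> \bar R) :
  measurable_fun setT f -> (forall t, 0 <= f t) ->
  \int[density_measure mq q0]_t f t = \int[nu]_t (f t * (q t)%:E).
Proof.
move=> mf f0.
pose f_ := nnsfun_approx measurableT mf.
transitivity (lim (\int[dens]_t (f_ n t)%:E @[n --> \oo])).
  rewrite -monotone_convergence//=.
  - apply: eq_integral => ? /[!inE] xD; apply/esym/cvg_lim => //=.
    exact: cvg_nnsfun_approx.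
  - by move=> n; exact/measurable_EFinP/measurable_funTS.
  - by move=> n ? _; rewrite lee_fin.
  - by move=> ? _ ? ? mn; rewrite lee_fin; exact/lefP/nd_nnsfun_approx.
rewrite [RHS](_ : _ = lim (\int[nu]_t ((f_ n t)%:E * (q t)%:E) @[n --> \oo])).
  by apply: congr_lim; apply/funext => n /=; exact: integral_density_nnsfun.
rewrite -monotone_convergence//=.
- apply: eq_integral => t _; apply/esym/cvg_lim => //.
  by apply: cvgeZr => //; exact: cvg_nnsfun_approx.
- by move=> n; apply: emeasurable_funM => //; exact/measurable_EFinP/measurable_funTS.
- by move=> n t _; rewrite mule_ge0 // lee_fin.
- move=> t _ m n mn; apply: lee_wpmul2r; first by rewrite lee_fin.
  by rewrite lee_fin; exact/lefP/nd_nnsfun_approx.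
Qed.

End Density.

Section Disintegration.
Context {R : realType} dO (Omega : measurableType dO) (P : probability Omega R).
Context dX (X : measurableType dX) dY (Y : measurableType dY).
Variables (nu : {sigma_finite_measure set Y -> \bar R}).
Variables (phi : Omega -> X) (V : Omega -> Y) (q : X * Y -> R).
Hypotheses (mphi : measurable_fun setT phi) (mV : measurable_fun setT V).
Hypotheses (mq : measurable_fun setT q) (q0 : forall u, 0 <= q u).
(* Conditionally on phi, the variable V has the density q(phi, .). *)
Hypothesis lawV : forall E A, measurable E -> measurable A ->
  P (phi @^-1` E `&` V @^-1` A) =
  (\int[P]_(w in phi @^-1` E) \int[nu]_(y in A) (q (phi w, y))%:E)%E.
Local Open Scope ereal_scope.

Let phi_mfun : {mfun Omega >-> X} :=
  HB.pack phi (isMeasurableFun.Build _ _ _ _ phi mphi).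

Let joint w := (phi w, V w).

Let mjoint : measurable_fun setT joint.
Proof. exact: measurable_fun_pair. Qed.

Let joint_mfun : {mfun Omega >-> (X * Y)%type} :=
  HB.pack joint (isMeasurableFun.Build _ _ _ _ joint mjoint).

Let law := @density_measure _ _ R (distribution P phi_mfun \x nu) _ mq q0.

(** Joint laws are determined by rectangles, where the hypothesis and Tonelli's
    theorem give the two values. *)
Let joint_law S : measurable S -> distribution P joint_mfun S = law S.
Proof.
pose C : set (set (X * Y)) :=
  [set C | exists A, measurable A /\ exists B, measurable B /\ C = A `*` B].
have CI : setI_closed C.
  move=> /= _ _ [X1 [mX1 [X2 [mX2 ->]]]] [Y1 [mY1 [Y2 [mY2 ->]]]].
  rewrite -setXI; exists (X1 `&` Y1); split; first exact: measurableI.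
  by exists (X2 `&` Y2); split => //; exact: measurableI.
move=> mS.
pose m2 : {measure set (X * Y) -> \bar R} :=
  @density_measure _ _ R (distribution P phi_mfun \x nu) _ mq q0.
apply: (@measure_unique _ _ _ C (fun=> setT) _ CI _ _ (distribution P joint_mfun) m2) => //.
- rewrite measurable_prod_measurableType //; congr (<<s _ >>).
  rewrite predeqE => s; split => [[A mA [B mB <-]]|[A [mA [B [mB ->]]]]].
    by exists A; split => //; exists B.
  by exists A => //; exists B.
- by move=> _; exists setT; split => //; exists setT; split => //; rewrite setXTT.
- by rewrite bigcup_const //; exists 0%N.
- move=> _ [A [mA [B [mB ->]]]].
  rewrite [LHS](_ : _ = P (phi @^-1` A `&` V @^-1` B)) // lawV //.
  rewrite [RHS](_ : _ = \int[distribution P phi_mfun \x nu]_(u in A `*` B) (q u)%:E) //.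
  rewrite [RHS]integral_mkcond; set g := _ \_ _.
  have mg : measurable_fun setT g.
    apply/(measurable_restrictT _ (measurableX mA mB)).
    by apply/measurable_EFinP/measurable_funTS.
  have g0 u : 0 <= g u by apply: erestrict_ge0 => ? _; rewrite lee_fin.
  rewrite fubini_tonelli1 // ge0_integral_distribution //; last 2 first.
  + exact: measurable_fun_fubini_tonelli_F.
  + by move=> x; apply: integral_ge0.
  rewrite [LHS]integral_mkcond; apply: (congr1 (fun f => \int[P]_w f w)).
  apply/funext => w.
  rewrite /= /fubini_F patchE /g; case: ifPn => [/set_mem wA|/negP wA].
    rewrite [LHS]integral_mkcond; apply: eq_integral => y _; rewrite !patchE.
    by rewrite in_setX /= (mem_set (wA : A (phi w))).
  rewrite integral0_eq // => y _; rewrite patchE in_setX /=.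
  by case: (boolP (phi w \in A)) => // /set_mem /mem_set /wA.
- move=> _.
  exact: (le_lt_trans (probability_le1 (distribution P joint_mfun) measurableT) (ltry 1)).
Qed.

(** Conditional expectations are only used in this integrated form: a
    nonnegative function of the pair (phi, V) is integrated over V with its
    conditional density, then over the sample space. *)
Lemma ge0_integral_disintegration (h : X * Y -> \bar R) :
  measurable_fun setT h -> (forall u, 0 <= h u) ->
  \int[P]_w h (phi w, V w) =
  \int[P]_w \int[nu]_y (h (phi w, y) * (q (phi w, y))%:E).
Proof.
move=> mh h0.
have mhq : measurable_fun setT (fun u => h u * (q u)%:E).
  by apply: emeasurable_funM => //; exact/measurable_EFinP.
have hq0 u : 0 <= h u * (q u)%:E by rewrite mule_ge0 // lee_fin.
transitivity (\int[distribution P joint_mfun]_u h u).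
  by rewrite ge0_integral_distribution.
pose m2 : {measure set (X * Y) -> \bar R} :=
  @density_measure _ _ R (distribution P phi_mfun \x nu) _ mq q0.
transitivity (\int[m2]_u h u).
  by apply: eq_measure_integral => A mA _; exact: joint_law.
rewrite ge0_integral_density // fubini_tonelli1 //.
rewrite ge0_integral_distribution //.
- exact: measurable_fun_fubini_tonelli_F.
- by move=> x; apply: integral_ge0.
Qed.

End Disintegration.

(** * Means under a density *)

Section WeightedMean.
Context {R : realType} d (Z : measurableType d).
Variables (mu : {measure set Z -> \bar R}) (q : Z -> R).
Hypotheses (mq : measurable_fun setT q) (q0 : forall z, 0 <= q z).

(** The integral of f is the difference of those of its positive and negative
    parts, and a difference involving an infinite term is infinite. *)
Lemma finite_integral_integrable (f : Z -> \bar R) (r : R) :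
  measurable_fun setT f -> (\int[mu]_z f z = r%:E)%E -> mu.-integrable setT f.
Proof.
move=> mf; rewrite integralE => fr.
have ip : (0 <= \int[mu]_z (f^\+)%E z)%E by apply: integral_ge0.
have im : (0 <= \int[mu]_z (f^\-)%E z)%E by apply: integral_ge0.
apply/integrableP; split => //.
rewrite (_ : (fun z => `|f z|%E) = (fun z => ((f^\+)%E z + (f^\-)%E z)%E)); last first.
  by rewrite -/(abse \o f) fune_abse.
rewrite ge0_integralD //; [|exact: measurable_funepos|exact: measurable_funeneg].
move: fr ip im; case: (\int[mu]_z _)%E => [u| |] //; case: (\int[mu]_z _)%E => [v| |] //=.
by rewrite -EFinD ltry.
Qed.

(** Integrability is part of the predicate, so that means can be combined
    linearly without side conditions. *)
Definition has_mean (g : Z -> R) (r : R) : Prop :=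
  mu.-integrable setT (fun z => (g z * q z)%:E) /\
  (\int[mu]_z (g z * q z)%:E = r%:E)%E.

Lemma has_mean_ext g g' r : g =1 g' -> has_mean g r -> has_mean g' r.
Proof. by move=> /funext ->. Qed.

Lemma has_meanD g h r s : has_mean g r -> has_mean h s ->
  has_mean (fun z => g z + h z) (r + s).
Proof.
move=> [ig gr] [ih hs]; rewrite /has_mean.
rewrite (_ : (fun z => _) = (fun z => (g z * q z)%:E + (h z * q z)%:E)%E); last first.
  by apply/funext => z; rewrite mulrDl.
by split; [exact: integrableD|rewrite integralD // gr hs].
Qed.

Lemma has_meanZ k g r : has_mean g r -> has_mean (fun z => k * g z) (k * r).
Proof.
move=> [ig gr]; rewrite /has_mean.
rewrite (_ : (fun z => _) = (fun z => k%:E * (g z * q z)%:E)%E); last first.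
  by apply/funext => z; rewrite -mulrA.
by split; [exact: integrableZl|rewrite integralZl // gr].
Qed.

Lemma has_mean0 : has_mean (fun=> 0) 0.
Proof.
rewrite /has_mean (_ : (fun z => _) = cst 0%E); last first.
  by apply/funext => z; rewrite mul0r.
by split; [exact: integrable0|exact: integral0].
Qed.

Lemma has_mean_sum (I : Type) (s : seq I) (g : I -> Z -> R) (r : I -> R) :
  (forall i, has_mean (g i) (r i)) ->
  has_mean (fun z => \sum_(i <- s) g i z) (\sum_(i <- s) r i).
Proof.
move=> gr; elim: s => [|i s IH].
  rewrite big_nil (_ : (fun z => _) = fun=> 0); first exact: has_mean0.
  by apply/funext => z; rewrite big_nil.
rewrite big_cons; apply: has_mean_ext (has_meanD (gr i) IH) => z.
by rewrite big_cons.
Qed.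

Lemma has_mean_dotv n (u : 'cV[R]_n) (g : Z -> 'cV[R]_n) (r : 'cV[R]_n) :
  (forall i, has_mean (fun z => g z i 0) (r i 0)) ->
  has_mean (fun z => dotv u (g z)) (dotv u r).
Proof.
move=> gr; rewrite dotvE.
apply: has_mean_ext (has_mean_sum _ (fun i => has_meanZ (u i 0) (gr i))) => z.
by rewrite dotvE.
Qed.

Lemma has_mean_le g h r s : has_mean g r -> has_mean h s ->
  (forall z, g z <= h z) -> r <= s.
Proof.
move=> [ig gr] [ih hs] gh; rewrite -lee_fin -gr -hs.
by apply: le_integral => // z _; rewrite lee_fin ler_wpM2r.
Qed.

(** The integral of a nonnegative function is the supremum of the integrals of
    the simple functions below it, hence monotone on all functions. *)
Lemma ge0_le_integral_nonmeasurable (f g : Z -> \bar R) :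
  (forall z, 0 <= f z)%E -> (forall z, f z <= g z)%E ->
  (\int[mu]_z f z <= \int[mu]_z g z)%E.
Proof.
move=> f0 fg; rewrite !ge0_integralTE //; last first.
  by move=> z; exact: le_trans (fg z).
apply: ub_ereal_sup => _ [h /= hf <-]; apply: ereal_sup_ubound; exists h => //= z.
exact: le_trans (fg z).
Qed.

Lemma ge0_has_mean (g : Z -> R) (k : R) : measurable_fun setT g -> (forall z, 0 <= g z) ->
  (\int[mu]_z (g z * q z)%:E <= k%:E)%E -> exists2 r, r <= k & has_mean g r.
Proof.
move=> mg g0 gk; have mgq : measurable_fun setT (fun z => (g z * q z)%:E).
  by apply/measurable_EFinP; apply: measurable_funM.
have : (0 <= \int[mu]_z (g z * q z)%:E)%E.
  by apply: integral_ge0 => z _; rewrite lee_fin mulr_ge0.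
case E : (\int[mu]_z _)%E gk => [r| |] // rk _.
by exists r => //; split=> //; exact: finite_integral_integrable E.
Qed.

Lemma integral_le_has_mean (g h : Z -> R) (r : R) : measurable_fun setT g -> (forall z, 0 <= g z) ->
  has_mean h r -> (forall z, g z <= h z) -> (\int[mu]_z (g z * q z)%:E <= r%:E)%E.
Proof.
move=> mg g0 [ih <-] gh; apply: ge0_le_integral_nonmeasurable => z.
  by rewrite lee_fin mulr_ge0.
by rewrite lee_fin ler_wpM2r.
Qed.

Lemma has_mean_cst k : (\int[mu]_z (q z)%:E = 1)%E -> has_mean (fun=> k) k.
Proof.
move=> q1; have h : has_mean (fun=> 1) 1.
  rewrite /has_mean (_ : (fun z => _) = EFin \o q); last first.
    by apply/funext => z; rewrite mul1r.
  by split=> //; apply: finite_integral_integrable q1; exact/measurable_EFinP.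
by rewrite -[X in has_mean _ X]mulr1; apply: has_mean_ext (has_meanZ k h) => z; rewrite mulr1.
Qed.

End WeightedMean.

(** * The Hessian estimator and the conditional error bound *)

Section PointwiseEstimates.
Context {R : realType} {n : nat} {dZ : measure_display} {Z : measurableType dZ}.
Variables (mu : {measure set Z -> \bar R}).
Variables (F : 'cV[R]_n -> R) (Ft : 'cV[R]_n -> Z -> R) (p : Z -> 'cV[R]_n -> R).
Variables (K : set 'cV[R]_n) (B G L : R).
Hypothesis hpb : nonoblivious_problem mu F Ft p K.
Hypothesis Kconv : convex_set K.
Hypotheses (G0 : 0 <= G) (L0 : 0 <= L).
Hypothesis hB : forall y c, K y -> `|Ft y c| <= B.
Hypothesis hGF : forall y c, K y -> enorm (grad_Ft Ft y c) <= G.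
Hypothesis hGp : forall y, K y ->
  (Ep mu p y (fun c => enorm (grad_logp p y c) ^+ 4)%R <= (G ^+ 4)%:E)%E.
Hypothesis hLF : forall y c, K y -> spnorm (hess_Ft Ft y c) <= L.
Hypothesis hLp : forall y, K y ->
  (Ep mu p y (fun c => spnorm (hess_logp p y c) ^+ 2)%R <= (L ^+ 2)%:E)%E.

(** Root mean square bound on the Hessian estimator, and therefore a Lipschitz
    constant of the gradient of F. *)
Definition Lbar : R := Num.sqrt (4 * B ^+ 2 * G ^+ 4 + 16 * G ^+ 4
                        + 4 * L ^+ 2 + 4 * B ^+ 2 * L ^+ 2).

Lemma Lbar_sqr : Lbar ^+ 2 = 4 * B ^+ 2 * G ^+ 4 + 16 * G ^+ 4
                        + 4 * L ^+ 2 + 4 * B ^+ 2 * L ^+ 2.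
Proof.
rewrite sqr_sqrtr //; have L2 := sqr_ge0 L.
have G4 : 0 <= G ^+ 4 by rewrite exprn_ge0.
have := mulr_ge0 (sqr_ge0 B) G4; have := mulr_ge0 (sqr_ge0 B) L2; lra.
Qed.

Lemma Lbar_ge0 : 0 <= Lbar.
Proof. exact: sqrtr_ge0. Qed.

Local Notation mean y := (has_mean mu (p ^~ y)).

Let mp y : measurable_fun setT (p ^~ y).
Proof. exact: (density_measurable hpb). Qed.

Let p0 y z : 0 <= p z y.
Proof. exact/ltW/(density_gt0 hpb). Qed.

Let mean_cst y k : mean y (fun=> k) k.
Proof. by apply: has_mean_cst => //; exact: (density_int1 hpb). Qed.

Lemma hess_estE y z i j : hess_est Ft p y z i j =
  Ft y z * (grad_logp p y z i 0 * grad_logp p y z j 0) + hess_Ft Ft y z i j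
  + grad_Ft Ft y z i 0 * grad_logp p y z j 0 + Ft y z * hess_logp p y z i j
  + grad_logp p y z i 0 * grad_Ft Ft y z j 0.
Proof.
rewrite /hess_est; move: (grad_logp p y z) (grad_Ft Ft y z) => g gF.
move: (hess_Ft Ft y z) (hess_logp p y z) => hF h.
by rewrite !mxE !big_ord1 !mxE.
Qed.

Lemma measurable_hess_est y i j : measurable_fun setT (fun z => hess_est Ft p y z i j).
Proof.
under eq_fun do rewrite hess_estE.
have mF := Ft_measurable hpb y; have mgF k := grad_Ft_measurable hpb y k.
have mg k := grad_logp_measurable hpb y k.
have mhF := hess_Ft_measurable hpb y i j; have mh := hess_logp_measurable hpb y i j.
apply: measurable_funD; last exact: measurable_funM (mg i) (mgF j).
apply: measurable_funD; last exact: measurable_funM mF mh.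
apply: measurable_funD; last exact: measurable_funM (mgF i) (mg j).
apply: measurable_funD mhF.
exact: measurable_funM mF (measurable_funM (mg i) (mg j)).
Qed.

Lemma mean_grad_Ft y u : K y ->
  mean y (fun z => dotv u (grad_Ft Ft y z)) (dotv u (grad F y)).
Proof.
move=> Ky; apply: has_mean_dotv => // i.
have e := grad_unbiased hpb Ky i; split=> //; apply: finite_integral_integrable e.
apply/measurable_EFinP/measurable_funM => //; exact: (grad_Ft_measurable hpb).
Qed.

Lemma mean_hess_est y u v : K y ->
  mean y (fun z => dotv u (hess_est Ft p y z *m v)) (dotv u (hess F y *m v)).
Proof.
move=> Ky; rewrite dotv_mulmx.
have h i j : mean y (fun z => u i 0 * v j 0 * hess_est Ft p y z i j)
                    (u i 0 * v j 0 * hess F y i j).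
  apply: has_meanZ; have e := hess_unbiased hpb Ky i j; split=> //.
  apply: finite_integral_integrable e.
  by apply/measurable_EFinP/measurable_funM => //; exact: measurable_hess_est.
apply: has_mean_ext (has_mean_sum _ (fun i => has_mean_sum _ (h i))) => z.
by rewrite dotv_mulmx.
Qed.

Lemma mean_grad_logp y : K y -> exists2 g4, g4 <= G ^+ 4 &
  mean y (fun z => enorm (grad_logp p y z) ^+ 4) g4.
Proof.
move=> Ky; apply: ge0_has_mean => //; last exact: hGp.
  by apply: measurable_funX; apply: measurable_enorm => i; exact: (grad_logp_measurable hpb).
by move=> z; rewrite exprn_ge0 // enorm_ge0.
Qed.

(** Testing on a fixed unit vector replaces the spectral norm by a lower bound
    that is measurable in z. *)
Lemma mean_hess_logp y v : K y -> exists2 l2, l2 <= L ^+ 2 * enorm v ^+ 2 &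
  mean y (fun z => enorm (hess_logp p y z *m v) ^+ 2) l2.
Proof.
move=> Ky.
have mh u : measurable_fun setT (fun z => enorm (hess_logp p y z *m u) ^+ 2).
  apply: measurable_funX; apply: measurable_enorm; apply: measurable_vec_mulmx.
    by move=> i j; exact: (hess_logp_measurable hpb).
  exact: measurable_vec_cst.
have h u : enorm u <= 1 -> exists2 l2, l2 <= L ^+ 2 &
    mean y (fun z => enorm (hess_logp p y z *m u) ^+ 2) l2.
  move=> u1; apply: ge0_has_mean => // [z|]; first by rewrite sqr_ge0.
  apply: le_trans (hLp Ky); apply: ge0_le_integral_nonmeasurable => z; rewrite lee_fin.
    by rewrite mulr_ge0 ?sqr_ge0.
  rewrite ler_wpM2r // ler_pXn2r ?nnegrE ?enorm_ge0 ?spnorm_ge0 //.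
  by rewrite (le_trans (enorm_mulmx _ _)) // ler_piMr ?spnorm_ge0.
have [v0|v0] := eqVneq (enorm v) 0.
  exists 0; first by rewrite v0 expr0n mulr0.
  apply: has_mean_ext (mean_cst y 0) => z.
  by rewrite (enorm_eq0 v0) mulmx0 enorm0 expr0n.
have vp : 0 < enorm v by rewrite lt_neqAle eq_sym v0 enorm_ge0.
have [|l2 l2L ml] := h ((enorm v)^-1 *: v).
  by rewrite enormZ ger0_norm ?invr_ge0 ?enorm_ge0 // mulVf.
exists (enorm v ^+ 2 * l2); first by rewrite mulrC ler_wpM2r ?sqr_ge0.
apply: has_mean_ext (has_meanZ (enorm v ^+ 2) ml) => z.
rewrite -scalemxAr enormZ exprMn mulrA ger0_norm ?invr_ge0 ?enorm_ge0 //.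
by rewrite -exprMn divff // expr1n mul1r.
Qed.

Lemma hess_est_sqr y z v : K y ->
  enorm (hess_est Ft p y z *m v) ^+ 2 <=
  (8 * G ^+ 4 + 4 * L ^+ 2) * enorm v ^+ 2
  + (4 * B ^+ 2 + 8) * enorm v ^+ 2 * enorm (grad_logp p y z) ^+ 4
  + 4 * B ^+ 2 * enorm (hess_logp p y z *m v) ^+ 2.
Proof.
move=> Ky; exact: (enorm_sqr_score_hessian _ _ _ (hB z Ky) (hGF z Ky) (hLF z Ky)).
Qed.

Lemma enorm_grad_F y : K y -> enorm (grad F y) <= G.
Proof.
move=> Ky; apply: le_enorm => //; set u := grad F y.
have m1 := has_meanZ 2 (mean_grad_Ft u Ky).
have := has_mean_le (p0 y) m1 (mean_cst y (dotv u u + G ^+ 2)).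
have H z : 2 * dotv u (grad_Ft Ft y z) <= dotv u u + G ^+ 2.
  rewrite (le_trans (dotv_young _ _)) // lerD2l -enorm_sqr.
  by rewrite ler_pXn2r ?nnegrE ?enorm_ge0 // hGF.
move=> /(_ H); lra.
Qed.

(** Jensen's inequality, by Young's inequality against the mean itself: the
    second moment of the estimator bounds the Hessian of F. *)
Lemma enorm_hess_F y v : K y -> enorm (hess F y *m v) <= Lbar * enorm v.
Proof.
move=> Ky; apply: le_enorm; first by rewrite mulr_ge0 ?Lbar_ge0 ?enorm_ge0.
set u := hess F y *m v.
have m1 := has_meanZ 2 (mean_hess_est u v Ky).
have [g4 g4G mg] := mean_grad_logp Ky; have [l2 l2L ml] := mean_hess_logp v Ky.
set k1 := (4 * B ^+ 2 + 8) * enorm v ^+ 2; set k2 := 4 * B ^+ 2.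
have k10 : 0 <= k1 by rewrite mulr_ge0 ?sqr_ge0 // addr_ge0 // mulr_ge0 ?sqr_ge0.
have k20 : 0 <= k2 by rewrite mulr_ge0 ?sqr_ge0.
have m2 := has_meanD (has_meanD (mean_cst y (dotv u u + (8 * G ^+ 4 + 4 * L ^+ 2) * enorm v ^+ 2))
  (has_meanZ k1 mg)) (has_meanZ k2 ml).
have := has_mean_le (p0 y) m1 m2 => /(_ _)/wrap[].
  move=> z; rewrite (le_trans (dotv_young _ _)) // -!addrA lerD2l -enorm_sqr.
  by rewrite addrA hess_est_sqr.
rewrite -/u exprMn Lbar_sqr.
have := ler_wpM2l k10 g4G; have := ler_wpM2l k20 l2L; rewrite /k1 /k2; lra.
Qed.

Lemma K_segment x y (s : R) : K x -> K y -> 0 <= s <= 1 -> K (x + s *: (y - x)).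
Proof.
move=> Kx Ky /andP[s0 s1].
have := Kconv (Itv01 s0 s1) (mem_set Ky) (mem_set Kx).
rewrite inE /conv /= /unstable.onem scalerBl scale1r.
by congr K; rewrite scalerBr addrCA addrA addrC addrA.
Qed.

Lemma grad_F_lipschitz x y : K x -> K y ->
  enorm (grad F y - grad F x) <= Lbar * enorm (y - x).
Proof.
move=> Kx Ky; apply: grad_lipschitz => [||s d s01].
- exact: (F_C2 hpb).
- exact: Lbar_ge0.
- by apply: enorm_hess_F; exact: K_segment.
Qed.

Lemma grad_Ft_lipschitz x y z : K x -> K y ->
  enorm (grad_Ft Ft y z - grad_Ft Ft x z) <= L * enorm (y - x).
Proof.
move=> Kx Ky; apply: grad_lipschitz => [||s d s01] //.
- exact: (Ft_C2 hpb).
- rewrite (le_trans (enorm_mulmx _ _)) // ler_wpM2r ?enorm_ge0 //.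
  by apply: hLF; exact: K_segment.
Qed.

Lemma F_descent x y : K x -> K y ->
  F y <= F x + dotv (grad F x) (y - x) + Lbar / 2 * enorm (y - x) ^+ 2.
Proof.
move=> Kx Ky; apply: descent_lemma => [|s s01]; first exact: (F_C2 hpb).
rewrite (le_trans (grad_F_lipschitz Kx (K_segment Kx Ky s01))) //.
by rewrite addrC addKr.
Qed.

(** One step of the recursion for the gradient error, conditionally on the
    past and on the position s of the query point m on the segment. The square
    of e' = r + U + V is expanded, where r is the damped old error, U the error
    of the Hessian correction and V that of the fresh gradient sample. Everything
    is bounded by affine functions of quantities whose means are known at m; in
    particular the sample is drawn at m and not at x, and V has a bias that the
    Lipschitz constants of the two gradients control. The term in q vanishes
    after averaging over s. *)
Lemma mean_error_step x x' d (s rho : R) m c r q :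
  K x -> K x' -> 0 <= s <= 1 -> 0 <= rho <= 1 ->
  m = x' + s *: (x - x') -> c = grad F x - grad F x' ->
  r = (1 - rho) *: (grad F x' - d) ->
  q = (2 * (1 - rho)) *: r + (4 * (1 - rho) ^+ 2) *: c ->
  (Ep mu p m (fun z => enorm (grad F x -
     ((1 - rho) *: (d + hess_est Ft p m z *m (x - x')) + rho *: grad_Ft Ft x z)) ^+ 2)%R
   <= (enorm r ^+ 2 + 2 * rho * (enorm r * ((Lbar + L) * enorm (x - x')))
       + 2 * (1 - rho) ^+ 2 * (Lbar ^+ 2 * enorm (x - x') ^+ 2) + 8 * rho ^+ 2 * G ^+ 2
       + (dotv q c - dotv q (hess F m *m (x - x'))))%:E)%E.
Proof.
move=> Kx Kx' s01 rho01 mE cE rE qE.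
have Km : K m by rewrite mE; exact: K_segment.
set del := x - x'; set w := 1 - rho in rE qE *; set nu := enorm del.
have /andP[rho0 rho1] := rho01.
have [g4 g4G mg] := mean_grad_logp Km; have [l2 l2L ml] := mean_hess_logp del Km.
(* Coefficients of |grad log p|^4 and |hess log p del|^2 in the bound on
   2 |U|^2 that [hess_est_sqr] provides. *)
set k1 := 2 * w ^+ 2 * ((4 * B ^+ 2 + 8) * nu ^+ 2); set k2 := 2 * w ^+ 2 * (4 * B ^+ 2).
have w20 : 0 <= 2 * w ^+ 2 by rewrite mulr_ge0 ?sqr_ge0.
have k10 : 0 <= k1.
  by rewrite mulr_ge0 // mulr_ge0 ?sqr_ge0 // addr_ge0 // mulr_ge0 ?sqr_ge0.
have k20 : 0 <= k2 by rewrite mulr_ge0 // mulr_ge0 ?sqr_ge0.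
pose bias := enorm r * ((Lbar + L) * nu).
pose A0 := enorm r ^+ 2 + 2 * w * dotv r c + 2 * rho * bias + 2 * rho * dotv r (grad F m)
  + 2 * w ^+ 2 * dotv c c + 2 * w ^+ 2 * ((8 * G ^+ 4 + 4 * L ^+ 2) * nu ^+ 2)
  + 8 * rho ^+ 2 * G ^+ 2.
have mtot := has_meanD (has_meanD (has_meanD (has_meanD (mean_cst m A0)
  (has_meanZ (- (2 * rho)) (mean_grad_Ft r Km))) (has_meanZ (-1) (mean_hess_est q del Km)))
  (has_meanZ k1 mg)) (has_meanZ k2 ml).
apply: (@le_trans _ _ (A0 + - (2 * rho) * dotv r (grad F m) + -1 * dotv q (hess F m *m del)
   + k1 * g4 + k2 * l2)%:E); last first.
  rewrite lee_fin /A0.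
  have := ler_wpM2l k10 g4G; have := ler_wpM2l k20 l2L.
  have := mulr_ge0 w20 (dotvv_ge0 c).
  have qc : dotv q c = 2 * w * dotv r c + 4 * w ^+ 2 * dotv c c.
    by rewrite qE dotvDl !dotvZl.
  rewrite qc Lbar_sqr -/nu -/bias /k1 /k2; lra.
apply: (integral_le_has_mean _ _ _ mtot) => // [|z|z]; last first.
- have hbias : enorm (grad F x - grad F m) + enorm (grad_Ft Ft m z - grad_Ft Ft x z)
      <= (Lbar + L) * nu.
    have hm : enorm (x - m) <= nu.
      have -> : x - m = (1 - s) *: del.
        by rewrite mE /del; apply/matrixP => i j; rewrite !mxE; ring.
      case/andP: s01 => s0 s1.
      by rewrite enormZ ger0_norm ?subr_ge0 // ler_piMl ?enorm_ge0 // lerBlDr lerDl.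
    rewrite [X in _ + X]enorm_distC mulrDl lerD //.
      by rewrite (le_trans (grad_F_lipschitz Km Kx)) // ler_wpM2l ?Lbar_ge0.
    by rewrite (le_trans (grad_Ft_lipschitz z Km Kx)) // ler_wpM2l.
  have hV : enorm (grad F x - grad_Ft Ft x z) <= 2 * G.
    rewrite (le_trans (enormD _ _)) // enormN.
    apply: le_trans (lerD (enorm_grad_F Kx) (hGF z Kx)) _.
    by rewrite [leRHS]mulrDl !mul1r.
  apply: le_trans (enorm_sqr_error_step (hess_est Ft p m z *m del) rho0 cE rE qE hV hbias) _.
  exact: substitute_bound w20 (hess_est_sqr z del Km).
- by rewrite sqr_ge0.
- apply: measurable_funX; apply: measurable_enorm.
  apply: measurable_vecB; first exact: measurable_vec_cst.
  apply: measurable_vecD; apply: measurable_vecZ; try exact: measurable_cst.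
    apply: measurable_vecD; first exact: measurable_vec_cst.
    apply: measurable_vec_mulmx; last exact: measurable_vec_cst.
    exact: measurable_hess_est.
  by move=> i; exact: (grad_Ft_measurable hpb).
Qed.

End PointwiseEstimates.

(** * Regularity of the problem data *)

Section ProblemMeasurability.
Context {R : realType} {n : nat} {dZ : measure_display} {Z : measurableType dZ}.
Variables (mu : {measure set Z -> \bar R}).
Variables (F : 'cV[R]_n -> R) (Ft : 'cV[R]_n -> Z -> R) (p : Z -> 'cV[R]_n -> R).
Variables (K : set 'cV[R]_n).
Hypothesis hpb : nonoblivious_problem mu F Ft p K.

(** A positive integrable density makes the reference measure sigma-finite, by
    Markov's inequality on the sets where the density exceeds 1 / (k + 1). *)
Lemma sigma_finite_density : sigma_finite setT mu.
Proof.
have mp0 := density_measurable hpb 0.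
pose A k := [set z | (k.+1%:R)^-1 <= p z 0].
have mA k : measurable (A k).
  rewrite (_ : A k = (p ^~ 0) @^-1` [set` `[(k.+1%:R)^-1, +oo[ : interval R]); last first.
    by apply/seteqP; split => z /=; rewrite in_itv /= andbT.
  by rewrite -[X in measurable X]setTI; apply: mp0 => //; exact: measurable_itv.
exists A.
  apply/seteqP; split => // z _.
  have pz : 0 < p z 0 := density_gt0 hpb z 0.
  have := @cvg_harmonic R => /cvgrPdist_lt /(_ _ pz) [k _ /(_ k (leqnn k))].
  rewrite sub0r normrN ger0_norm => [kp|]; last by rewrite invr_ge0.
  by exists k => //; exact: ltW.
move=> k; split=> //.
have : (\int[mu]_(z in A k) (k.+1%:R^-1)%:E <= 1)%E.
  rewrite -(density_int1 hpb 0).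
  apply: (@le_trans _ _ (\int[mu]_(z in A k) (p z 0)%:E)%E).
    apply: ge0_le_integral => //.
    - by apply/measurable_EFinP; exact: measurable_funTS.
  apply: ge0_subset_integral => //; first exact/measurable_EFinP.
  by move=> z _; rewrite lee_fin; exact/ltW/(density_gt0 hpb).
have -> := integral_cst mu (mA k) (k.+1%:R^-1)%:E.
case: (mu (A k)) => [r| |] h //; first exact: ltry.
by move: h; rewrite gt0_muley // lte_fin invr_gt0.
Qed.

Let continuous_C2 (f : 'cV[R]_n -> R) : twice_cont_diff f -> continuous f.
Proof. by move=> [df _ _] x; exact: differentiable_continuous. Qed.

Let continuous_grad (f : 'cV[R]_n -> R) i :
  twice_cont_diff f -> continuous (fun x => grad f x i 0).
Proof. by move=> [_ df _] x; exact: differentiable_continuous. Qed.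

Let continuous_hess (f : 'cV[R]_n -> R) i j :
  twice_cont_diff f -> continuous (fun x => hess f x i j).
Proof. by move=> [_ _ df]. Qed.

Lemma continuous_density z : continuous (p z).
Proof.
rewrite (_ : p z = (fun x => expR (logp p z x))); last first.
  by apply/funext => x; rewrite /logp lnK // posrE (density_gt0 hpb).
move=> x; apply: continuous_comp; last exact: continuous_expR.
exact: continuous_C2 (logp_C2 hpb z) x.
Qed.

Lemma continuous_hess_est z i j : continuous (fun x => hess_est Ft p x z i j).
Proof.
have cF := continuous_C2 (Ft_C2 hpb z); have cgF k := @continuous_grad _ k (Ft_C2 hpb z).
have cg k := @continuous_grad _ k (logp_C2 hpb z).
have chF := @continuous_hess _ i j (Ft_C2 hpb z).
have ch := @continuous_hess _ i j (logp_C2 hpb z).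
under eq_fun do rewrite hess_estE.
move=> x.
exact: (cvgD (cvgD (cvgD (cvgD (cvgM (cF x) (cvgM (cg i x) (cg j x))) (chF x))
  (cvgM (cgF i x) (cg j x))) (cvgM (cF x) (ch x))) (cvgM (cg i x) (cgF j x))).
Qed.

Section Compositions.
Context d (T : measurableType d) (X : T -> 'cV[R]_n) (V : T -> Z).
Hypotheses (mX : measurable_vec X) (mV : measurable_fun setT V).

Lemma measurable_comp_F : measurable_fun setT (fun t => F (X t)).
Proof.
apply: (measurable_caratheodory (f := fun x (_ : Z) => F x) _ _ mX mV) => [_|x].
  exact: continuous_C2 (F_C2 hpb).
exact: measurable_cst.
Qed.

Lemma measurable_comp_grad_F : measurable_vec (fun t => grad F (X t)).
Proof.
move=> i; apply: (measurable_caratheodory (f := fun x (_ : Z) => grad F x i 0) _ _ mX mV).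
  by move=> _; exact: continuous_grad (F_C2 hpb).
by move=> x; exact: measurable_cst.
Qed.

Lemma measurable_comp_hess_F i j : measurable_fun setT (fun t => hess F (X t) i j).
Proof.
apply: (measurable_caratheodory (f := fun x (_ : Z) => hess F x i j) _ _ mX mV).
  by move=> _; exact: continuous_hess (F_C2 hpb).
by move=> x; exact: measurable_cst.
Qed.

Lemma measurable_comp_density : measurable_fun setT (fun t => p (V t) (X t)).
Proof.
apply: (measurable_caratheodory (f := fun x y => p y x) _ _ mX mV).
  exact: continuous_density.
exact: (density_measurable hpb).
Qed.

Lemma measurable_comp_grad_Ft : measurable_vec (fun t => grad_Ft Ft (X t) (V t)).
Proof.
move=> i; apply: (measurable_caratheodory (f := fun x y => grad_Ft Ft x y i 0) _ _ mX mV).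
  by move=> y; exact: continuous_grad (Ft_C2 hpb y).
by move=> x; exact: (grad_Ft_measurable hpb).
Qed.

Lemma measurable_comp_hess_est i j :
  measurable_fun setT (fun t => hess_est Ft p (X t) (V t) i j).
Proof.
apply: (measurable_caratheodory (f := fun x y => hess_est Ft p x y i j) _ _ mX mV).
  by move=> y; exact: continuous_hess_est.
by move=> x; exact: (measurable_hess_est hpb).
Qed.

End Compositions.

End ProblemMeasurability.

(** * The past of a run and its sampling rules *)

Section RunMeasurability.
Context {R : realType} {n : nat} {dZ : measure_display} {Z : measurableType dZ}.
Variables (mu : {measure set Z -> \bar R}).
Variables (F : 'cV[R]_n -> R) (Ft : 'cV[R]_n -> Z -> R) (p : Z -> 'cV[R]_n -> R).
Variables (K : set 'cV[R]_n).
Hypothesis hpb : nonoblivious_problem mu F Ft p K.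
Context {dO : measure_display} {Omega : measurableType dO}.
Variables (P : probability Omega R).
Variables (a : nat -> Omega -> R) (z : nat -> Omega -> Z).
Variables (x dir v : nat -> Omega -> 'cV[R]_n) (x1 : 'cV[R]_n) (T : nat).
Variables (rho eta : nat -> R).
Hypothesis hrun : one_sfw_run mu Ft p P a z x dir v K x1 T rho eta.

(** Conditioning on the past is expressed by measurability on these two copies
    of the sample space. *)
Definition past_space t := g_sigma_algebraType
  (\bigcup_(s in [set s | (1 <= s < t)%N]) sfw_events a z v s).

Definition past_a_space t := g_sigma_algebraType
  (sfw_past a z v t `|` preimage_set_system setT (a t) measurable).

Let event_past s t (E : set Omega) : (1 <= s < t)%N -> sfw_events a z v s E ->
  measurable (E : set (past_space t)).
Proof. by move=> st sE; apply: sub_sigma_algebra; exists s. Qed.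

Lemma past_measurable t (E : set Omega) : (t <= T.+1)%N ->
  measurable (E : set (past_space t)) -> measurable E.
Proof.
move=> tT; apply: smallest_sub; first exact: sigma_algebra_measurable.
move=> A [s /= /andP[s1 st] sA].
have sT : (1 <= s <= T)%N by rewrite s1 -ltnS (leq_trans st).
case: sA => [[[B mB <-]|[s2 [B mB <-]]]|[i _ [B mB <-]]].
- exact: (sfw_z_measurable hrun sT).
- by apply: (sfw_a_measurable hrun) => //; rewrite s2; case/andP: sT.
- exact: (sfw_v_measurable hrun i sT).
Qed.

Lemma past_a_measurable t (E : set Omega) : (2 <= t <= T)%N ->
  measurable (E : set (past_a_space t)) -> measurable E.
Proof.
move=> tT; apply: smallest_sub; first exact: sigma_algebra_measurable.
move=> A [|[B mB <-]]; last exact: (sfw_a_measurable hrun tT).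
by apply: past_measurable; case/andP: tT => _ /leqW.
Qed.

Lemma measurable_id_past t : (t <= T.+1)%N ->
  measurable_fun setT (id : Omega -> past_space t).
Proof. by move=> tT _ E mE; rewrite setTI; exact: past_measurable mE. Qed.

Lemma measurable_id_past_a t : (2 <= t <= T)%N ->
  measurable_fun setT (id : Omega -> past_a_space t).
Proof. by move=> tT _ E mE; rewrite setTI; exact: past_a_measurable mE. Qed.

Lemma measurable_past_a_past t :
  measurable_fun setT (id : past_a_space t -> past_space t).
Proof. by move=> _ E mE; rewrite setTI; apply: sub_sigma_algebra; left. Qed.

Lemma measurable_past_mono s t : (s <= t)%N ->
  measurable_fun setT (id : past_space t -> past_space s).
Proof.
move=> st _ E mE; rewrite setTI; move: E mE.
apply: smallest_sub; first exact: smallest_sigma_algebra.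
move=> A [r /= /andP[r1 rs] rA]; apply: event_past rA.
by rewrite r1 (leq_trans rs).
Qed.

Lemma measurable_a_past_a t : measurable_fun setT (a t : past_a_space t -> R).
Proof.
move=> _ E mE; rewrite setTI; apply: sub_sigma_algebra; right; exists E => //.
by rewrite setTI.
Qed.

Lemma measurable_z_past t : (1 <= t)%N -> measurable_fun setT (z t : past_space t.+1 -> Z).
Proof.
move=> t1 _ E mE; rewrite setTI; apply: (@event_past t); first by rewrite ltnSn t1.
by left; left; exists E => //; rewrite setTI.
Qed.

Lemma measurable_a_past t : (2 <= t)%N -> measurable_fun setT (a t : past_space t.+1 -> R).
Proof.
move=> t2 _ E mE; rewrite setTI; apply: (@event_past t); first by rewrite ltnSn (ltnW t2).
by left; right; split=> //; exists E => //; rewrite setTI.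
Qed.

Lemma measurable_v_past t : (1 <= t)%N ->
  measurable_vec (v t : past_space t.+1 -> 'cV[R]_n).
Proof.
move=> t1 i _ E mE; rewrite setTI; apply: (@event_past t); first by rewrite ltnSn t1.
by right; exists i => //; exists E => //; rewrite setTI.
Qed.

Lemma measurable_x_past t : (1 <= t <= T.+1)%N ->
  measurable_vec (x t : past_space t -> 'cV[R]_n).
Proof.
elim: t => [//|[|t] IH] tT.
  rewrite (_ : x 1%N = fun=> x1); first exact: measurable_vec_cst.
  by apply/funext => w; exact: (sfw_x_init hrun).
have tT' : (1 <= t.+1 <= T)%N by [].
have mx : measurable_vec (x t.+1 : past_space t.+2 -> 'cV[R]_n).
  have := IH; rewrite /= ltnW // => /(_ isT).
  exact: (measurable_vec_comp (measurable_past_mono (leqnSn t.+1))).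
rewrite (_ : x t.+2 = fun w => x t.+1 w + eta t.+1 *: (v t.+1 w - x t.+1 w)).
  apply: (measurable_vecD mx).
  apply: (@measurable_vecZ _ _ _ (past_space t.+2) (fun=> eta t.+1)).
    exact: measurable_cst.
  exact: (measurable_vecB (measurable_v_past _) mx).
by apply/funext => w; exact: (sfw_x_step hrun).
Qed.

Lemma measurable_mid d (S : measurableType d) (phi : S -> Omega) t :
  measurable_vec (x t \o phi) -> measurable_vec (x t.-1 \o phi) ->
  measurable_fun setT (a t \o phi) -> measurable_vec (sfw_mid a x t \o phi).
Proof.
move=> mx mx' ma; apply: (measurable_vecD (f := fun w => a t (phi w) *: x t (phi w))).
  exact: measurable_vecZ.
apply: (measurable_vecZ (k := fun w => 1 - a t (phi w))) => //.
by apply: measurable_funB => //; exact: measurable_cst.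
Qed.

Lemma measurable_dir_past t : (1 <= t <= T)%N ->
  measurable_vec (dir t : past_space t.+1 -> 'cV[R]_n).
Proof.
elim: t => [//|t IH] tT.
have mz : measurable_fun setT (z t.+1 : past_space t.+2 -> Z).
  exact: measurable_z_past.
case: t => [|t] in IH tT mz *.
  rewrite (_ : dir 1%N = fun w => grad_Ft Ft x1 (z 1%N w)).
    exact: (measurable_comp_grad_Ft hpb (@measurable_vec_cst _ _ _ (past_space 2) x1) mz).
  by apply/funext => w; exact: (sfw_dir_init hrun).
have mdir : measurable_vec (dir t.+1 : past_space t.+3 -> 'cV[R]_n).
  have := IH; rewrite /= ltnW // => /(_ isT).
  exact: (measurable_vec_comp (measurable_past_mono (leqnSn t.+2))).
have mx : measurable_vec (x t.+2 : past_space t.+3 -> 'cV[R]_n).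
  apply: (measurable_vec_comp (measurable_past_mono (leqnSn t.+2))).
  by apply: measurable_x_past; exact: leqW.
have mx' : measurable_vec (x t.+1 : past_space t.+3 -> 'cV[R]_n).
  have le13 : (t.+1 <= t.+3)%N by rewrite ltnW.
  apply: (measurable_vec_comp (measurable_past_mono le13)).
  by apply: measurable_x_past; exact: (leqW (ltnW tT)).
have ma : measurable_fun setT (a t.+2 : past_space t.+3 -> R).
  exact: measurable_a_past.
have mm : measurable_vec (sfw_mid a x t.+2 : past_space t.+3 -> 'cV[R]_n).
  exact: (@measurable_mid _ (past_space t.+3) id).
rewrite (_ : dir t.+2 = fun w => (1 - rho t.+2) *: (dir t.+1 w
    + hess_est Ft p (sfw_mid a x t.+2 w) (z t.+2 w) *m (x t.+2 w - x t.+1 w))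
    + rho t.+2 *: grad_Ft Ft (x t.+2 w) (z t.+2 w)); last first.
  by apply/funext => w; exact: (sfw_dir_step hrun (t := t.+2) tT).
apply: (@measurable_vecD _ _ _ (past_space t.+3)).
  apply: (@measurable_vecZ _ _ _ (past_space t.+3) (fun=> 1 - rho t.+2)).
    exact: measurable_cst.
  apply: (measurable_vecD mdir); apply: measurable_vec_mulmx.
    by move=> i j; exact: (measurable_comp_hess_est hpb mm mz).
  exact: measurable_vecB mx mx'.
apply: (@measurable_vecZ _ _ _ (past_space t.+3) (fun=> rho t.+2)).
  exact: measurable_cst.
exact: (measurable_comp_grad_Ft hpb mx mz).
Qed.

Lemma measurable_mid_past_a t : (2 <= t <= T)%N ->
  measurable_vec (sfw_mid a x t : past_a_space t -> 'cV[R]_n).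
Proof.
move=> /andP[t2 tT'].
have mpast s : (1 <= s <= t)%N -> measurable_vec (x s : past_a_space t -> 'cV[R]_n).
  move=> /andP[s1 st].
  apply: (measurable_vec_comp (measurableT_comp (measurable_past_mono st)
    (@measurable_past_a_past t))).
  by apply: measurable_x_past; rewrite s1 (leq_trans st) // leqW.
apply: (@measurable_mid _ (past_a_space t) id).
- by apply: mpast; rewrite leqnn (ltnW t2).
- by apply: mpast; rewrite leq_pred andbT -ltnS prednK // ltnW.
- exact: measurable_a_past_a.
Qed.

(** The sampling rule of z_t in integrated form; the density is jointly
    measurable because it is continuous in the query point. *)
Lemma expectation_sample_z t (h : past_a_space t * Z -> \bar R) : (2 <= t <= T)%N ->
  measurable_fun setT h -> (forall u, 0 <= h u)%E ->
  (\int[P]_w h (w, z t w) =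
   \int[P]_w \int[mu]_y (h (w, y) * (p y (sfw_mid a x t w))%:E))%E.
Proof.
move=> tT mh h0.
pose mu' : {sigma_finite_measure set Z -> \bar R} :=
  HB.pack (Measure.sort mu) (isSigmaFinite.Build dZ Z R mu (sigma_finite_density hpb))
    (isSFinite.Build dZ Z R mu (sfinite_measure_sigma_finite (sigma_finite_density hpb))).
have mm := measurable_mid_past_a tT.
apply: (@ge0_integral_disintegration R _ Omega P _ (past_a_space t) _ Z mu' id (z t)
  (fun u => p u.2 (sfw_mid a x t u.1))) => //.
- exact: measurable_id_past_a.
- by apply: (sfw_z_measurable hrun); case/andP: tT => /ltnW ->.
- apply: (measurable_comp_density hpb _ measurable_snd).
  exact: (measurable_vec_comp measurable_fst mm).
- by move=> u; exact/ltW/(density_gt0 hpb).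
- move=> E A mE mA; exact: (sfw_z_law hrun).
Qed.

(** Independence of a_t from the past says that its conditional density with
    respect to the uniform law is 1. *)
Lemma expectation_sample_a t (h : past_space t * R -> \bar R) : (2 <= t <= T)%N ->
  measurable_fun setT h -> (forall u, 0 <= h u)%E ->
  (\int[P]_w h (w, a t w) =
   \int[P]_w \int[lebesgue_measure]_(s in `[0%R, 1%R]) h (w, s))%E.
Proof.
move=> tT mh h0; have [t2 tT'] := andP tT.
have mhw w : measurable_fun setT (fun s : R => h (w, s)).
  exact: (measurableT_comp mh (measurable_pair1 w)).
rewrite (@ge0_integral_disintegration R _ Omega P _ (past_space t) _ _
  (uniform_prob (@ltr01 R)) id (a t) (fun=> 1)) => //.
- apply: (congr1 (fun f => \int[P]_w f w)%E); apply/funext => w.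
  rewrite integral_uniform; last 2 first.
  + under eq_fun do rewrite mule1.
    exact: mhw.
  + by move=> s; rewrite mule1.
  rewrite subr0 invr1 mul1e.
  by apply: eq_integral => s _; rewrite mule1.
- by apply: measurable_id_past; exact: leqW.
- exact: (sfw_a_measurable hrun).
- move=> E A mE mA.
  have mE' : measurable (E : set Omega) by apply: past_measurable mE; exact: leqW.
  rewrite -[LHS]/(P (E `&` a t @^-1` A)) (sfw_a_indep hrun) // (sfw_a_uniform hrun) //.
  have iA := integral_cst (uniform_prob (@ltr01 R)) mA 1%E.
  rewrite mul1e in iA.
  have iE := integral_cst P mE' (uniform_prob (@ltr01 R) A).
  by rewrite muleC -iE; apply: (congr1 (integral _ _)); apply/funext => w; rewrite -iA.
Qed.

End RunMeasurability.

(** * Arithmetic of the rates *)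

Section Recursions.
Context {R : realType}.

(** The arithmetic of the recursion e' <= (1 - 1/s)^2 e + O(1/s^2): the three
    lower bounds on C are what makes C / s reproduce itself. *)
Lemma rate_recursion (s C A M k : R) : 1 <= s -> 0 <= M ->
  4 * A <= C -> 256 <= C -> (2 * M) ^+ 4 <= C -> 0 <= k -> k ^+ 2 = C / s ->
  (1 - s^-1) ^+ 2 * (C / s) + 2 * (s^-1 ^+ 2 * (1 - s^-1) * M) * k + 2 * s^-1 ^+ 2 * A
  <= C / (s + 1).
Proof.
move=> s1 M0 hA h256 hM k0 k2.
have s0 : 0 < s by exact: lt_le_trans s1.
have C0 : 0 <= C by lra.
(* The three lower bounds on C say that its fourth root c is at least 4 and
   2 M, and that A <= C / 4; hence M k <= (c / 2) c^2 <= C / 8. *)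
pose c := Num.sqrt (Num.sqrt C).
have c0 : 0 <= c by exact: sqrtr_ge0.
have cc : c ^+ 2 = Num.sqrt C by rewrite sqr_sqrtr // sqrtr_ge0.
have c4 : c ^+ 4 = C by rewrite (exprM c 2 2) cc sqr_sqrtr.
have c_ge4 : 4 <= c.
  rewrite -(@ler_pXn2r _ 4) ?nnegrE // c4; apply: le_trans h256.
  by rewrite -natrX ler_nat.
have c_geM : 2 * M <= c by rewrite -(@ler_pXn2r _ 4) ?nnegrE ?mulr_ge0 // c4.
have kc : k <= c ^+ 2.
  rewrite -(@ler_pXn2r _ 2) ?nnegrE ?exprn_ge0 // k2 -exprM c4.
  by rewrite ler_pdivrMr // ler_peMr.
have Mk : 8 * (M * k) <= C.
  rewrite -c4; have : M * k <= (c / 2) * c ^+ 2 by apply: ler_pM => //; lra.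
  have : 4 * c ^+ 3 <= c ^+ 4 by rewrite [c ^+ 4]exprS ler_wpM2r // exprn_ge0.
  lra.
set i := s^-1; have i0 : 0 < i by rewrite invr_gt0.
have i1 : i <= 1 by rewrite invf_le1.
have h1 : 2 * (i ^+ 2 * (1 - i) * M) * k <= i ^+ 2 * (1 - i) * (C / 4).
  have -> : 2 * (i ^+ 2 * (1 - i) * M) * k = i ^+ 2 * (1 - i) * (2 * (M * k)) by ring.
  by rewrite ler_wpM2l ?mulr_ge0 ?sqr_ge0 ?subr_ge0 //; lra.
have h2 : 2 * i ^+ 2 * A <= i ^+ 2 * (C / 2).
  have -> : 2 * i ^+ 2 * A = i ^+ 2 * (2 * A) by ring.
  by rewrite ler_wpM2l ?sqr_ge0 //; lra.
apply: (@le_trans _ _ (C * ((1 - i) ^+ 2 * i + i ^+ 2 * (1 - i) / 4 + i ^+ 2 / 2))).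
  by rewrite -/i; lra.
rewrite ler_wpM2l // -[leRHS]mul1r ler_pdivlMr; last by rewrite addr_gt0.
have -> : s = i^-1 by rewrite invrK.
have -> : ((1 - i) ^+ 2 * i + i ^+ 2 * (1 - i) / 4 + i ^+ 2 / 2) * (i^-1 + 1)
   = 1 - i * (1 + 2 * i - 3 * i ^+ 2) / 4 by field; rewrite lt0r_neq0.
rewrite gerBl divr_ge0 // mulr_ge0 ?(ltW i0) //; nra.
Qed.

(** Telescoping, by 1 / w <= 2 (w - u) for u^2 + 1 = w^2. *)
Lemma sum_invsqrt_le (m : nat) :
  \sum_(0 <= i < m) (Num.sqrt i.+1%:R)^-1 <= 2 * Num.sqrt m%:R :> R.
Proof.
elim: m => [|m IH]; first by rewrite big_geq // sqrtr0 mulr0.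
rewrite big_nat_recr //= (le_trans (lerD IH (lexx _))) //.
set u := Num.sqrt m%:R; set w := Num.sqrt m.+1%:R.
have u0 : 0 <= u by exact: sqrtr_ge0.
have w0 : 0 < w by rewrite sqrtr_gt0.
have u2 : u ^+ 2 = m%:R by rewrite sqr_sqrtr.
have w2 : w ^+ 2 = m%:R + 1 by rewrite sqr_sqrtr // natr1.
have uw : u <= w by rewrite ler_sqrt // ler_nat.
rewrite -(ler_pM2r w0) mulrDl mulVf ?lt0r_neq0 //.
have := sqr_ge0 (w - u); nra.
Qed.

Lemma sum_inv_le (m : nat) :
  \sum_(0 <= i < m.+1) (i.+1%:R)^-1 <= 1 + ln m.+1%:R :> R.
Proof.
elim: m => [|m IH]; first by rewrite big_nat1 invr1 ln1 addr0.
rewrite big_nat_recr //= (le_trans (lerD IH (lexx _))) // -addrA lerD2l.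
have m0 : 0 < m.+1%:R :> R by rewrite ltr0n.
have m20 : 0 < m.+2%:R :> R by rewrite ltr0n.
have e : 1 + - (m.+2%:R)^-1 = m.+1%:R / m.+2%:R :> R.
  apply: (mulIf (lt0r_neq0 m20)); rewrite divfK ?lt0r_neq0 // mulrDl mul1r mulNr.
  by rewrite mulVf ?lt0r_neq0 // -natr1 addrK.
have := @le_ln1Dx R (- (m.+2%:R)^-1); rewrite ltrN2 invf_lt1 // ltr1n => /(_ isT).
by rewrite e ln_div ?posrE // lerBlDl lerBrDr.
Qed.

End Recursions.

(** * The recursions for the gradient error and the optimality gap *)

Section ExpectationBound.
Context {R : realType} {dO : measure_display} {Omega : measurableType dO}.
Variables (P : probability Omega R).

(** Both recursions below are instances, f being the quantity of the previous
    round. *)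
Lemma expectation_affine_le (h f g : Omega -> R) (A C c b1 b2 : R) :
  (forall w, 0 <= h w) -> (forall w, 0 <= f w) -> (forall w, 0 <= g w) ->
  measurable_fun setT f -> measurable_fun setT g -> 0 <= A -> 0 <= C -> 0 <= c ->
  (forall w, h w <= A * f w + C * g w + c) ->
  (\int[P]_w (f w)%:E <= b1%:E)%E -> (\int[P]_w (g w)%:E <= b2%:E)%E ->
  (\int[P]_w (h w)%:E <= (A * b1 + C * b2 + c)%:E)%E.
Proof.
move=> h0 f0 g0 mf mg A0 C0 c0 hfg fb gb.
have mEf : measurable_fun setT (EFin \o f) by exact/measurable_EFinP.
have mEg : measurable_fun setT (EFin \o g) by exact/measurable_EFinP.
apply: (@le_trans _ _ (\int[P]_w ((A%:E * (f w)%:E + C%:E * (g w)%:E) + c%:E)%E)%E).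
  by apply: ge0_le_integral_nonmeasurable => w; rewrite ?lee_fin.
have e1 w : (0 <= A%:E * (f w)%:E)%E by rewrite lee_fin mulr_ge0.
have e2 w : (0 <= C%:E * (g w)%:E)%E by rewrite lee_fin mulr_ge0.
have m1 : measurable_fun setT (fun w => (A%:E * (f w)%:E)%E).
  by apply: emeasurable_funM => //; exact: measurable_cst.
have m2 : measurable_fun setT (fun w => (C%:E * (g w)%:E)%E).
  by apply: emeasurable_funM => //; exact: measurable_cst.
have c0' (w : Omega) : (0 <= (cst c%:E : Omega -> \bar R) w)%E by rewrite lee_fin.
rewrite (ge0_integralD P measurableT (fun w _ => adde_ge0 (e1 w) (e2 w))
  (emeasurable_funD m1 m2) (fun w _ => c0' w) (measurable_cst _)).
rewrite (ge0_integralD P measurableT (fun w _ => e1 w) m1 (fun w _ => e2 w) m2).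
have f0' w : (0 <= (EFin \o f) w)%E by rewrite lee_fin.
have g0' w : (0 <= (EFin \o g) w)%E by rewrite lee_fin.
rewrite (ge0_integralZl P measurableT mEf (fun w _ => f0' w)) ?lee_fin //.
rewrite (ge0_integralZl P measurableT mEg (fun w _ => g0' w)) ?lee_fin //.
have -> : (\int[P]_w (cst c%:E : Omega -> \bar R) w = c%:E)%E.
  by rewrite integral_cst // -[RHS]mule1; congr (_ * _)%E; exact: probability_setT.
rewrite 2!EFinD !EFinM.
by rewrite !leeD // lee_wpmul2l // lee_fin.
Qed.

End ExpectationBound.

Section Convergence.
Context {R : realType} {n : nat} {dZ : measure_display} {Z : measurableType dZ}.
Variables (mu : {measure set Z -> \bar R}).
Variables (F : 'cV[R]_n -> R) (Ft : 'cV[R]_n -> Z -> R) (p : Z -> 'cV[R]_n -> R).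
Variables (K : set 'cV[R]_n) (D B G L : R).
Hypothesis hpb : nonoblivious_problem mu F Ft p K.
Hypothesis Kconv : convex_set K.
Hypothesis hD : forall y y', K y -> K y' -> enorm (y - y') <= D.
Hypotheses (G0 : 0 <= G) (L0 : 0 <= L) (D0 : 0 <= D).
Hypothesis hB : forall y c, K y -> `|Ft y c| <= B.
Hypothesis hGF : forall y c, K y -> enorm (grad_Ft Ft y c) <= G.
Hypothesis hGp : forall y, K y ->
  (Ep mu p y (fun c => enorm (grad_logp p y c) ^+ 4)%R <= (G ^+ 4)%:E)%E.
Hypothesis hLF : forall y c, K y -> spnorm (hess_Ft Ft y c) <= L.
Hypothesis hLp : forall y, K y ->
  (Ep mu p y (fun c => spnorm (hess_logp p y c) ^+ 2)%R <= (L ^+ 2)%:E)%E.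
Context {dO : measure_display} {Omega : measurableType dO}.
Variables (P : probability Omega R).
Variables (a : nat -> Omega -> R) (z : nat -> Omega -> Z).
Variables (x dir v : nat -> Omega -> 'cV[R]_n) (x1 : 'cV[R]_n) (T : nat).
Hypothesis hx1 : K x1.
Hypothesis hrun : one_sfw_run mu Ft p P a z x dir v K x1 T
              (fun t => (t.-1%:R)^-1) (fun t => (t%:R)^-1).

Local Notation Lb := (Lbar B G L).

Definition grad_error t w : 'cV[R]_n := grad F (x t w) - dir t w.

Lemma iterate_in_K t w : (1 <= t <= T.+1)%N -> K (x t w).
Proof.
elim: t => [//|[|t] IH] tT; first by rewrite (sfw_x_init hrun).
have tT' : (1 <= t.+1 <= T)%N by [].
have [Kv _] := sfw_v_argmin hrun tT' w.
rewrite (sfw_x_step hrun tT'); apply: K_segment => //.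
  by apply: IH; exact: leqW.
by rewrite invr_ge0 ler0n invf_le1 ?ltr0n // ler1n.
Qed.

Lemma iterate_step t w : (1 <= t <= T)%N -> enorm (x t.+1 w - x t w) <= (t%:R)^-1 * D.
Proof.
move=> tT; have [t1 tT'] := andP tT; have [Kv _] := sfw_v_argmin hrun tT w.
rewrite (sfw_x_step hrun tT) addrC addKr enormZ ger0_norm ?invr_ge0 //.
rewrite ler_wpM2l ?invr_ge0 //; apply: hD => //; apply: iterate_in_K.
by rewrite t1 leqW.
Qed.

Lemma measurable_iterate t : (1 <= t <= T.+1)%N -> measurable_vec (x t).
Proof.
move=> tT; have [_ tT'] := andP tT.
exact: (measurable_vec_comp (measurable_id_past hrun tT') (measurable_x_past hrun tT)).
Qed.

Lemma measurable_grad_error t : (1 <= t <= T)%N -> measurable_vec (grad_error t).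
Proof.
move=> tT; have [t1 tT'] := andP tT.
apply: measurable_vecB; last first.
  have tT1 : (t.+1 <= T.+1)%N by [].
  exact: (measurable_vec_comp (measurable_id_past hrun tT1) (measurable_dir_past hpb hrun tT)).
apply: (measurable_comp_grad_F hpb); last exact: (sfw_z_measurable hrun tT).
by apply: measurable_iterate; rewrite t1 leqW.
Qed.

Section OneStep.
Variable t : nat.
Hypothesis tT : (2 <= t <= T)%N.
Let rho : R := (t.-1%:R)^-1.
Let del w := x t w - x t.-1 w.
Let r w := (1 - rho) *: grad_error t.-1 w.

(** What remains of the bound of [mean_error_step] once the terms in q have
    averaged out. *)
Definition averaged_error w : R :=
  enorm (r w) ^+ 2 + 2 * rho * (enorm (r w) * ((Lb + L) * enorm (del w)))
  + 2 * (1 - rho) ^+ 2 * (Lb ^+ 2 * enorm (del w) ^+ 2) + 8 * rho ^+ 2 * G ^+ 2.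

Let c w := grad F (x t w) - grad F (x t.-1 w).
Let q w := (2 * (1 - rho)) *: r w + (4 * (1 - rho) ^+ 2) *: c w.
Let query w s := x t.-1 w + s *: del w.

Let bound w s : R :=
  averaged_error w + (dotv (q w) (c w) - dotv (q w) (hess F (query w s) *m del w)).

Let ext_bound (u : past_space a z v t * R) : \bar R :=
  (if (0 <= u.2 <= 1)%R then (Num.max 0 (bound u.1 u.2))%:E else +oo)%E.

Let next_error (w : Omega) (y : Z) : 'cV[R]_n :=
  grad F (x t w) - ((1 - rho) *: (dir t.-1 w + hess_est Ft p (sfw_mid a x t w) y *m del w)
    + rho *: grad_Ft Ft (x t w) y).

Let rho01 : 0 <= rho <= 1.
Proof.
have t1 : (0 < t.-1)%N by rewrite -ltnS prednK; case/andP: tT => // /ltnW.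
by rewrite invr_ge0 ler0n invf_le1 ?ltr0n // ler1n.
Qed.

Let Kx w : K (x t w).
Proof.
by apply: iterate_in_K; case/andP: tT => t2 tT'; rewrite (ltnW t2) leqW.
Qed.

Let Kx' w : K (x t.-1 w).
Proof.
apply: iterate_in_K; case/andP: tT => t2 tT'.
by rewrite -ltnS prednK ?(ltnW t2) // t2 /= (leq_trans (leq_pred t)) // leqW.
Qed.

Let grad_error_next w : grad_error t w = next_error w (z t w).
Proof.
by rewrite /grad_error (sfw_dir_step hrun tT) /next_error.
Qed.

Let mean_next_error w s : 0 <= s <= 1 ->
  (Ep mu p (query w s) (fun y => enorm (grad F (x t w) -
     ((1 - rho) *: (dir t.-1 w + hess_est Ft p (query w s) y *m del w)
       + rho *: grad_Ft Ft (x t w) y)) ^+ 2)%R <= (bound w s)%:E)%E.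
Proof.
move=> s01.
exact: (mean_error_step hpb Kconv G0 L0 hB hGF hGp hLF hLp (Kx w) (Kx' w) s01 rho01
  erefl erefl erefl erefl).
Qed.

Let bound_ge0 w s : 0 <= s <= 1 -> 0 <= bound w s.
Proof.
move=> s01; rewrite -lee_fin; apply: le_trans (mean_next_error w s01).
apply: integral_ge0 => y _; rewrite lee_fin mulr_ge0 ?sqr_ge0 //.
exact/ltW/(density_gt0 hpb).
Qed.

Let mx : measurable_vec (x t : past_space a z v t -> 'cV[R]_n).
Proof.
by apply: (measurable_x_past hrun); case/andP: tT => t2 tT'; rewrite (ltnW t2) leqW.
Qed.

Let t1_bounds : (1 <= t.-1 <= T)%N.
Proof.
case/andP: tT => t2 tT'.
by rewrite -ltnS prednK ?(ltnW t2) // t2 /= (leq_trans (leq_pred t)).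
Qed.

Let mx' : measurable_vec (x t.-1 : past_space a z v t -> 'cV[R]_n).
Proof.
have t1T : (1 <= t.-1 <= T.+1)%N by case/andP: t1_bounds => -> /leqW ->.
exact: (measurable_vec_comp (@measurable_past_mono _ _ _ _ _ _ a z v _ _ (leq_pred t))
  (measurable_x_past hrun t1T)).
Qed.

Let mdir : measurable_vec (dir t.-1 : past_space a z v t -> 'cV[R]_n).
Proof.
have := measurable_dir_past hpb hrun t1_bounds.
by rewrite prednK //; case/andP: tT => /ltnW.
Qed.

Let merr : measurable_vec (grad_error t.-1 : past_space a z v t -> 'cV[R]_n).
Proof.
apply: (measurable_vecB _ mdir).
exact: (measurable_comp_grad_F hpb mx' (measurable_cst (point : Z))).
Qed.

Let mdel : measurable_vec (del : past_space a z v t -> 'cV[R]_n).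
Proof. exact: measurable_vecB. Qed.

Let mr : measurable_vec (r : past_space a z v t -> 'cV[R]_n).
Proof.
apply: (@measurable_vecZ _ _ _ (past_space a z v t) (fun=> 1 - rho)) merr.
exact: measurable_cst.
Qed.

Let mc : measurable_vec (c : past_space a z v t -> 'cV[R]_n).
Proof.
apply: measurable_vecB.
  exact: (measurable_comp_grad_F hpb mx (measurable_cst (point : Z))).
exact: (measurable_comp_grad_F hpb mx' (measurable_cst (point : Z))).
Qed.

Let mq : measurable_vec (q : past_space a z v t -> 'cV[R]_n).
Proof.
apply: measurable_vecD.
  apply: (@measurable_vecZ _ _ _ (past_space a z v t) (fun=> 2 * (1 - rho))) mr.
  exact: measurable_cst.
apply: (@measurable_vecZ _ _ _ (past_space a z v t) (fun=> 4 * (1 - rho) ^+ 2)) mc.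
exact: measurable_cst.
Qed.

Let maveraged : measurable_fun setT (averaged_error : past_space a z v t -> R).
Proof.
have mer := measurable_enorm mr; have med := measurable_enorm mdel.
have mk (k : R) : measurable_fun setT (fun _ : past_space a z v t => k).
  exact: measurable_cst.
apply: measurable_funD (mk _); apply: measurable_funD.
  apply: measurable_funD; first exact: measurable_funX.
  apply: measurable_funM (mk _) _; apply: measurable_funM mer _.
  exact: measurable_funM (mk _) med.
apply: measurable_funM (mk _) _; apply: measurable_funM (mk _) _.
exact: measurable_funX.
Qed.

Let mext_bound : measurable_fun setT ext_bound.
Proof.
have mf : measurable_fun setT (fst : past_space a z v t * R -> past_space a z v t).
  exact: measurable_fst.
have ms : measurable_fun setT (snd : past_space a z v t * R -> R) by exact: measurable_snd.
have mdel1 : measurable_vec (del \o (fst : past_space a z v t * R -> past_space a z v t)).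
  exact: measurable_vec_comp mf mdel.
have mq1 : measurable_vec (q \o (fst : past_space a z v t * R -> past_space a z v t)).
  exact: measurable_vec_comp mf mq.
have mpoint : measurable_vec (fun u : past_space a z v t * R => query u.1 u.2).
  apply: measurable_vecD; first exact: (measurable_vec_comp mf mx').
  exact: (measurable_vecZ ms mdel1).
have mbound : measurable_fun setT (fun u : past_space a z v t * R => bound u.1 u.2).
  apply: measurable_funD; first exact: (measurableT_comp maveraged mf).
  apply: measurable_funB.
    exact: (measurable_dotv mq1 (measurable_vec_comp mf mc)).
  apply: (measurable_dotv mq1); apply: measurable_vec_mulmx mdel1 => i j.
  exact: (measurable_comp_hess_F hpb mpoint (measurable_cst (point : Z))).
apply: measurable_fun_ifT; last exact: measurable_cst.
  apply: measurable_and; apply: measurable_fun_ler => //; exact: measurable_cst.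
by apply/measurable_EFinP; apply: measurable_maxr => //; exact: measurable_cst.
Qed.

(** The mean of hess F along the segment, applied to del, is exactly c, so the
    terms in q cancel. *)
Let averaged_ext_bound w :
  (\int[lebesgue_measure]_(s in `[0%R, 1%R]) ext_bound (w, s) = (averaged_error w)%:E)%E.
Proof.
pose k := averaged_error w + dotv (q w) (c w).
have -> : averaged_error w = k - dotv (q w) (grad F (x t.-1 w + del w) - grad F (x t.-1 w)).
  by rewrite /del subrKC /k -addrA subrr addr0.
rewrite -(integral_hess_line _ _ _ _ (F_C2 hpb)); apply: eq_integral => s.
rewrite inE /= in_itv /= => s01; rewrite /ext_bound /= s01.
have /max_idPr -> := bound_ge0 w s01.
by rewrite /bound /k addrA.
Qed.

(** One step of the mean square error recursion. The conditional bound given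
    the past and a_t holds when a_t lies in [0, 1], which is almost sure; it is
    extended by +oo elsewhere, so that it holds everywhere. *)
Lemma mean_square_error_step :
  (\int[P]_w (enorm (grad_error t w) ^+ 2)%:E <= \int[P]_w (averaged_error w)%:E)%E.
Proof.
pose h (u : past_a_space a z v t * Z) := (enorm (next_error u.1 u.2) ^+ 2)%:E.
have mh : measurable_fun setT h.
  pose S := (past_a_space a z v t * Z)%type.
  have mf : measurable_fun setT (fst : S -> past_a_space a z v t) by exact: measurable_fst.
  have ms : measurable_fun setT (snd : S -> Z) by exact: measurable_snd.
  have mp := measurableT_comp (@measurable_past_a_past _ _ _ _ _ _ a z v t) mf.
  have mx1 := measurable_vec_comp mp mx; have mdir1 := measurable_vec_comp mp mdir.
  have mdel1 := measurable_vec_comp mp mdel.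
  have mm := measurable_vec_comp mf (measurable_mid_past_a hrun tT).
  apply/measurable_EFinP; apply: measurable_funX; apply: measurable_enorm.
  apply: (@measurable_vecB _ _ _ S); first exact: (measurable_comp_grad_F hpb mx1 ms).
  apply: (@measurable_vecD _ _ _ S).
    apply: (@measurable_vecZ _ _ _ S (fun=> 1 - rho)); first exact: measurable_cst.
    apply: (measurable_vecD mdir1); apply: measurable_vec_mulmx mdel1 => i j.
    exact: (measurable_comp_hess_est hpb mm ms).
  apply: (@measurable_vecZ _ _ _ S (fun=> rho)); first exact: measurable_cst.
  exact: (measurable_comp_grad_Ft hpb mx1 ms).
rewrite (_ : (fun w => _) = (fun w => h (w, z t w))); last first.
  by apply/funext => w; rewrite /h grad_error_next.
rewrite (expectation_sample_z hpb hrun tT mh); last by move=> u; rewrite lee_fin sqr_ge0.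
apply: (@le_trans _ _ (\int[P]_w ext_bound (w, a t w))%E).
  apply: ge0_le_integral_nonmeasurable => w.
    apply: integral_ge0 => y _; rewrite mule_ge0 ?lee_fin ?sqr_ge0 //.
    exact/ltW/(density_gt0 hpb).
  rewrite /ext_bound /=; case: ifPn => [a01|_]; last exact: leey.
  have midE : sfw_mid a x t w = query w (a t w).
    rewrite /sfw_mid /query /del; apply/matrixP => i j; rewrite !mxE; ring.
  apply: (@le_trans _ _ (bound w (a t w))%:E); last by rewrite lee_fin le_max lexx orbT.
  by have := mean_next_error w a01; rewrite -midE.
rewrite (expectation_sample_a hrun tT mext_bound).
  by under eq_integral do rewrite averaged_ext_bound.
by move=> u; rewrite /ext_bound; case: ifP => _; rewrite ?leey // lee_fin le_max lexx.
Qed.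

Lemma averaged_error_ge0 w : 0 <= averaged_error w.
Proof.
have /andP[r0 r1] := rho01; have Lb0 := Lbar_ge0 B G L.
apply: addr_ge0; last by apply: mulr_ge0; [apply: mulr_ge0|]; rewrite ?sqr_ge0.
apply: addr_ge0; last by apply: mulr_ge0; apply: mulr_ge0; rewrite ?sqr_ge0.
apply: addr_ge0; first by rewrite sqr_ge0.
apply: mulr_ge0; first by rewrite mulr_ge0.
apply: mulr_ge0; first exact: enorm_ge0.
by apply: mulr_ge0; rewrite ?addr_ge0 ?enorm_ge0.
Qed.

End OneStep.
Section Rates.
Variable C : R.
Hypotheses (C1 : 4 * (2 * G + D * Lb) ^+ 2 <= C) (C2 : 256 <= C).
Hypothesis C3 : (2 * D * (Lb + L)) ^+ 4 <= C.

Let C0 : 0 < C.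
Proof. by apply: lt_le_trans C2; rewrite ltr0n. Qed.

Let Lb0 : 0 <= Lb.
Proof. exact: Lbar_ge0. Qed.

Let kappa t : R := Num.sqrt (C / t%:R).

Let kappa_gt0 t : (1 <= t)%N -> 0 < kappa t.
Proof. by move=> t1; rewrite sqrtr_gt0 divr_gt0 // ltr0n. Qed.

Let kappa_sqr t : kappa t ^+ 2 = C / t%:R.
Proof. by rewrite sqr_sqrtr // divr_ge0 // ltW. Qed.

(** The arithmetic-geometric mean inequality at the expected size k of e keeps
    the recursions linear in the mean square error, and loses nothing when that
    error is k^2. *)
Let linearize (e k : R) : 0 < k -> e <= k^-1 / 2 * e ^+ 2 + k / 2.
Proof.
move=> k0; rewrite -(ler_pM2l k0).
have -> : k * (k^-1 / 2 * e ^+ 2 + k / 2) = e ^+ 2 / 2 + k ^+ 2 / 2.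
  by field; rewrite lt0r_neq0.
have := sqr_ge0 (e - k); nra.
Qed.

Lemma mean_square_error_first w : enorm (grad_error 1 w) ^+ 2 <= C.
Proof.
apply: le_trans C1; have DL := mulr_ge0 D0 Lb0.
have : enorm (grad_error 1 w) <= 2 * G.
  rewrite /grad_error (sfw_dir_init hrun) (sfw_x_init hrun).
  apply: le_trans (enormD _ _) _; rewrite enormN [leRHS]mulrDl !mul1r.
  apply: lerD; first exact: (enorm_grad_F hpb G0 hGF).
  exact: hGF.
have := enorm_ge0 (grad_error 1 w); move: (enorm _) (D * Lb) DL => e y; nra.
Qed.

Lemma averaged_error_le t w (i M : R) : (1 <= t)%N -> (t.+1 <= T)%N ->
  i = (t%:R)^-1 -> M = D * (Lb + L) ->
  averaged_error t.+1 w <=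
  ((1 - i) ^+ 2 + i ^+ 2 * (1 - i) * M * (kappa t)^-1) * enorm (grad_error t w) ^+ 2
  + 0 * 0 + (i ^+ 2 * (1 - i) * M * kappa t + 2 * i ^+ 2 * ((D * Lb) ^+ 2 + 4 * G ^+ 2)).
Proof.
move=> t1 tT iE ME; rewrite /averaged_error /= -iE.
have i0 : 0 <= i by rewrite iE invr_ge0.
have i1 : i <= 1 by rewrite iE invf_le1 ?ltr0n // ler1n.
have w0 : 0 <= 1 - i by rewrite subr_ge0.
have M0 : 0 <= M by rewrite ME mulr_ge0 ?addr_ge0.
have hn : enorm (x t.+1 w - x t w) <= i * D.
  by rewrite iE; apply: iterate_step; rewrite t1 ltnW.
rewrite enormZ (ger0_norm w0).
have n0 := enorm_ge0 (x t.+1 w - x t w); have e0 := enorm_ge0 (grad_error t w).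
have k0 := kappa_gt0 t1.
move: (enorm (x t.+1 w - x t w)) (enorm (grad_error t w)) (kappa t) hn n0 e0 k0.
move=> nu e k hn n0 e0 k0.
have h1 : 2 * i * ((1 - i) * e * ((Lb + L) * nu)) <=
    i ^+ 2 * (1 - i) * M * (2 * (k^-1 / 2 * e ^+ 2 + k / 2)).
  apply: (@le_trans _ _ (i ^+ 2 * (1 - i) * M * (2 * e))).
    have -> : i ^+ 2 * (1 - i) * M * (2 * e) = 2 * i * ((1 - i) * e * ((Lb + L) * (i * D))).
      by rewrite ME; ring.
    apply: ler_wpM2l; first by rewrite mulr_ge0.
    apply: ler_wpM2l; first by rewrite mulr_ge0.
    by apply: ler_wpM2l => //; rewrite addr_ge0.
  apply: ler_wpM2l; first by rewrite mulr_ge0 // mulr_ge0 ?sqr_ge0.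
  by apply: ler_wpM2l => //; exact: linearize.
have h2 : 2 * (1 - i) ^+ 2 * (Lb ^+ 2 * nu ^+ 2) <= 2 * i ^+ 2 * (D * Lb) ^+ 2.
  have -> : 2 * i ^+ 2 * (D * Lb) ^+ 2 = 2 * (1 * (Lb ^+ 2 * (i * D) ^+ 2)) by ring.
  rewrite -mulrA ler_wpM2l // ler_pM ?sqr_ge0 ?mulr_ge0 ?sqr_ge0 //.
    by rewrite expr_le1 // lerBlDr lerDl.
  by rewrite ler_wpM2l ?sqr_ge0 // ler_pXn2r ?nnegrE ?mulr_ge0.
rewrite exprMn; move: h1 h2; lra.
Qed.

(** Induction on t: damping by (1 - 1/t)^2 absorbs the second-order noise and
    bias of each round. *)
Lemma mean_square_error_le t : (1 <= t <= T)%N ->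
  (\int[P]_w (enorm (grad_error t w) ^+ 2)%:E <= (C / t%:R)%:E)%E.
Proof.
have z0 : (\int[P]_w ((fun=> 0) w)%:E <= 0%:E)%E.
  by rewrite integral0_eq.
have mN s : (1 <= s <= T)%N -> measurable_fun setT (fun w => enorm (grad_error s w) ^+ 2).
  by move=> sT; apply: measurable_funX; apply: measurable_enorm; exact: measurable_grad_error.
elim: t => [//|[|t] IH] tT.
  rewrite divr1 -[C]add0r -[X in (X + C)%:E](addr0 0) -[X in (X + _ + C)%:E](mul0r 0).
  rewrite -[X in (_ + X + C)%:E](mul0r 0).
  apply: (expectation_affine_le (f := fun=> 0) (g := fun=> 0)) => //; try exact: measurable_cst.
  - by move=> w; rewrite sqr_ge0.
  - exact: ltW.
  - by move=> w; rewrite !mul0r !add0r mean_square_error_first.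
have tT1 : (1 <= t.+1 <= T)%N by exact: ltnW.
have tT2 : (2 <= t.+2 <= T)%N by exact: tT.
apply: (le_trans (mean_square_error_step tT2)).
pose i : R := (t.+1%:R)^-1; pose M := D * (Lb + L).
have i0 : 0 <= i by rewrite invr_ge0.
have i1 : 0 <= 1 - i by rewrite subr_ge0 invf_le1 ?ltr0n // ler1n.
have M0 : 0 <= M by rewrite mulr_ge0 ?addr_ge0.
have k0 : 0 < kappa t.+1 by exact: kappa_gt0.
have A0 : 0 <= (1 - i) ^+ 2 + i ^+ 2 * (1 - i) * M * (kappa t.+1)^-1.
  apply: addr_ge0; first by rewrite sqr_ge0.
  apply: mulr_ge0; last by rewrite invr_ge0 ltW.
  by apply: mulr_ge0 => //; apply: mulr_ge0; rewrite ?sqr_ge0.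
have c0 : 0 <= i ^+ 2 * (1 - i) * M * kappa t.+1 + 2 * i ^+ 2 * ((D * Lb) ^+ 2 + 4 * G ^+ 2).
  apply: addr_ge0; apply: mulr_ge0; rewrite ?(ltW k0) //.
  - by apply: mulr_ge0 => //; apply: mulr_ge0; rewrite ?sqr_ge0.
  - by rewrite mulr_ge0 ?sqr_ge0.
  - by rewrite addr_ge0 ?sqr_ge0 // mulr_ge0 ?sqr_ge0.
apply: le_trans (expectation_affine_le (averaged_error_ge0 tT2)
  (fun w => sqr_ge0 (enorm (grad_error t.+1 w))) (fun=> lexx 0)
  (mN _ tT1) (measurable_cst _) A0 (lexx 0) c0
  (fun w => averaged_error_le w (isT : (1 <= t.+1)%N) tT (erefl i) (erefl M)) (IH tT1) z0) _.
rewrite lee_fin -[t.+2%:R]natr1.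
have s1 : 1 <= t.+1%:R :> R by rewrite ler1n.
have hA : 4 * ((D * Lb) ^+ 2 + 4 * G ^+ 2) <= C.
  apply: le_trans C1; have := mulr_ge0 (mulr_ge0 D0 Lb0) G0; nra.
have hM : (2 * M) ^+ 4 <= C by rewrite /M mulrA.
apply: le_trans _ (rate_recursion s1 M0 hA C2 hM (ltW k0) (kappa_sqr t.+1)).
rewrite -kappa_sqr -/i.
have kk : (kappa t.+1)^-1 * kappa t.+1 ^+ 2 = kappa t.+1.
  by rewrite expr2 mulKf // lt0r_neq0.
have := congr1 ( *%R (i ^+ 2 * (1 - i) * M)) kk.
move: (kappa t.+1) (kappa t.+1)^-1 => k k'; lra.
Qed.

Variable xs : 'cV[R]_n.
Hypotheses (hxs : K xs) (hmin : forall y, K y -> F xs <= F y).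
Hypothesis Fconv : convex_function K F.

Let gap t w : R := F (x t w) - F xs.

Let gap_ge0 t w : (1 <= t <= T.+1)%N -> 0 <= gap t w.
Proof. by move=> tT; rewrite subr_ge0; apply: hmin; exact: iterate_in_K. Qed.

(** The Frank-Wolfe step. The gradient error is paired with the difference of
    two points of K, the linear minimization is used against the minimizer, and
    convexity turns the remaining term into minus the gap; the step size 1 / t
    makes t times the gap telescope. *)
Lemma gap_step t w : (1 <= t <= T)%N ->
  t%:R * gap t.+1 w <= t.-1%:R * gap t w + D * enorm (grad_error t w)
                       + Lb * D ^+ 2 / 2 * (t%:R)^-1.
Proof.
move=> tT; have [t1 tT'] := andP tT.
have Kt : K (x t w) by apply: iterate_in_K; rewrite t1 leqW.
have Kt1 : K (x t.+1 w) by apply: iterate_in_K.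
have [Kv vmin] := sfw_v_argmin hrun tT w.
have dFx : differentiable F (x t w) by have [dF _ _] := F_C2 hpb; exact: dF.
have conv := convex_grad_le dFx Fconv Kt hxs.
have desc := F_descent hpb Kconv G0 hB hGF hGp hLF hLp Kt Kt1.
have hn := iterate_step w tT.
set i := (t%:R)^-1 in hn *.
have i0 : 0 <= i by rewrite invr_ge0.
have n2 : enorm (x t.+1 w - x t w) ^+ 2 <= (i * D) ^+ 2.
  by rewrite ler_pXn2r ?nnegrE ?enorm_ge0 ?mulr_ge0.
have stepE : x t.+1 w - x t w = i *: (v t w - x t w).
  by rewrite (sfw_x_step hrun tT) addrC addKr.
have lin : dotv (grad F (x t w)) (v t w - x t w) <=
    D * enorm (grad_error t w) + (F xs - F (x t w)).
  have -> : dotv (grad F (x t w)) (v t w - x t w) =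
      dotv (grad_error t w) (v t w - xs) + (dotv (v t w) (dir t w) - dotv xs (dir t w))
      + dotv (grad F (x t w)) (xs - x t w).
    rewrite /grad_error (dotvC (v t w)) (dotvC xs) !(dotvDl, dotvDr, dotvNl, dotvNr); ring.
  have := vmin _ hxs; have := cauchy_schwarz (grad_error t w) (v t w - xs).
  have := ler_wpM2l (enorm_ge0 (grad_error t w)) (hD Kv hxs).
  move: conv; move: (dotv _ (xs - x t w)) (dotv _ (v t w - xs)) => b1 b2.
  move: (enorm (v t w - xs)) (enorm _) (F xs) (F (x t w)) => b3 b4 b5 b6.
  move: (dotv (v t w) _) (dotv xs _) => b7 b8; lra.
have ti : t%:R * i = 1 by rewrite mulfV // pnatr_eq0 -lt0n.
have tpred : t.-1%:R = t%:R - 1 :> R by rewrite -[in RHS](prednK t1) -natr1 addrK.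
rewrite stepE dotvZr -stepE in desc.
have Lb2 : 0 <= Lb / 2 by rewrite divr_ge0.
have m1 := ler_wpM2l (ler0n R t) desc.
have m2 := ler_wpM2l Lb2 n2.
have m3 := ler_wpM2l (ler0n R t) m2.
rewrite tpred /gap.
move: m1 m3 lin ti; move: (dotv _ _) (enorm (x t.+1 w - x t w) ^+ 2) => g y.
move: (enorm _) => e.
move: (F xs) (F (x t w)) (F (x t.+1 w)) => f0 f1 f2.
move: (t%:R : R) => tt m1 m3 lin ti.
have e1 : tt * (f1 + i * g + Lb / 2 * y) = tt * f1 + (tt * i) * g + tt * (Lb / 2 * y) by ring.
have e2 : tt * (Lb / 2 * (i * D) ^+ 2) = (tt * i) * (Lb * D ^+ 2 / 2 * i) by field.
rewrite e1 ti in m1; rewrite e2 ti in m3; lra.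
Qed.

Lemma measurable_gap t : (1 <= t <= T.+1)%N -> measurable_fun setT (gap t).
Proof.
move=> tT; apply: measurable_funB; last exact: measurable_cst.
exact: (measurable_comp_F hpb (measurable_iterate tT) (measurable_cst (point : Z))).
Qed.

Let S (t : nat) : R :=
  \sum_(0 <= i < t) (D * kappa i.+1 + Lb * D ^+ 2 / 2 * (i.+1%:R)^-1).

Lemma expected_weighted_gap t : (t <= T)%N ->
  (\int[P]_w (t%:R * gap t.+1 w)%:E <= (S t)%:E)%E.
Proof.
elim: t => [_|t IH tT].
  rewrite /S big_geq // integral0_eq // => w _; by rewrite mul0r.
have tT1 : (1 <= t.+1 <= T)%N by [].
have tT2 : (1 <= t.+1 <= T.+1)%N by exact: leqW tT.
have k0 : 0 < kappa t.+1 by exact: kappa_gt0.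
have DL0 : 0 <= Lb * D ^+ 2 / 2 by rewrite divr_ge0 // mulr_ge0 ?sqr_ge0.
have c0 : 0 <= D * kappa t.+1 / 2 + Lb * D ^+ 2 / 2 * (t.+1%:R)^-1.
  by rewrite addr_ge0 ?divr_ge0 ?mulr_ge0 ?(ltW k0) ?invr_ge0 // ?divr_ge0 ?mulr_ge0 ?sqr_ge0.
have A0 : 0 <= D * ((kappa t.+1)^-1 / 2) by rewrite mulr_ge0 // divr_ge0 // invr_ge0 ltW.
apply: le_trans (expectation_affine_le _ _
  (fun w => sqr_ge0 (enorm (grad_error t.+1 w))) _ _ ler01 A0 c0 _
  (IH (ltnW tT)) (mean_square_error_le tT1)) _.
- by move=> w; rewrite mulr_ge0 // gap_ge0.
- by move=> w; rewrite mulr_ge0 // gap_ge0.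
- by apply: measurable_funM; [exact: measurable_cst|exact: measurable_gap].
- by apply: measurable_funX; apply: measurable_enorm; exact: measurable_grad_error.
- move=> w; have := gap_step w tT1; rewrite /=.
  have := ler_wpM2l D0 (linearize (enorm (grad_error t.+1 w)) k0).
  move: (enorm _) (kappa t.+1) (kappa t.+1)^-1 (gap t.+1 w) (gap t.+2 w) => e k k' b1 b2.
  by move: (t.+1%:R) (t.+1%:R)^-1 (t%:R) => c1 c2 c3; lra.
rewrite lee_fin /S big_nat_recr //= -kappa_sqr.
have -> : D * ((kappa t.+1)^-1 / 2) * kappa t.+1 ^+ 2 = D * kappa t.+1 / 2.
  by field; rewrite lt0r_neq0.
rewrite mul1r -addrA lerD2l addrA -splitr.
by [].
Qed.

Lemma expected_gap : (1 <= T)%N ->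
  (\int[P]_w (F (x T.+1 w) - F xs)%:E <=
   (2 * Num.sqrt C * D / Num.sqrt T%:R + Lb * D ^+ 2 * (1 + ln T%:R) / (2 * T%:R))%:E)%E.
Proof.
move=> T1.
have z0 : (\int[P]_w ((fun=> 0) w)%:E <= 0%:E)%E by rewrite integral0_eq.
have Tp : 0 < T%:R :> R by rewrite ltr0n.
have TT : (1 <= T.+1 <= T.+1)%N by rewrite leqnn.
have iT : 0 <= (T%:R)^-1 :> R by rewrite invr_ge0 ltW.
have h := expectation_affine_le (fun w => gap_ge0 w TT)
  (fun w => mulr_ge0 (ler0n R T) (gap_ge0 w TT)) (fun=> lexx 0)
  (measurable_funM (measurable_cst _) (measurable_gap TT)) (measurable_cst _)
  iT (lexx 0) (lexx 0) _ (expected_weighted_gap (leqnn T)) z0.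
apply: le_trans (h _) _.
  by move=> w; rewrite mul0r !addr0 mulKf // lt0r_neq0.
rewrite lee_fin mul0r !addr0.
have ST : S T <= D * Num.sqrt C * (2 * Num.sqrt T%:R) + Lb * D ^+ 2 / 2 * (1 + ln T%:R).
  rewrite /S big_split /= lerD //.
    have -> : \sum_(0 <= i < T) D * kappa i.+1 =
        D * Num.sqrt C * \sum_(0 <= i < T) (Num.sqrt i.+1%:R)^-1.
      rewrite big_distrr /=; apply: eq_bigr => i _.
      by rewrite /kappa sqrtrM ?(ltW C0) // sqrtrV // mulrA.
    by rewrite ler_wpM2l ?mulr_ge0 ?sqrtr_ge0 // sum_invsqrt_le.
  rewrite -big_distrr /=; apply: ler_wpM2l; first by rewrite divr_ge0 // mulr_ge0 ?sqr_ge0.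
  by rewrite -(prednK T1) sum_inv_le.
apply: (le_trans (ler_wpM2l iT ST)).
set u := Num.sqrt T%:R.
have u2 : T%:R = u ^+ 2 by rewrite sqr_sqrtr // ltW.
have u0 : u != 0 by rewrite lt0r_neq0 // sqrtr_gt0.
rewrite le_eqVlt; apply/orP; left; apply/eqP.
move: (ln _) => l; rewrite u2; field; exact: u0.
Qed.

End Rates.
End Convergence.

(** * Convergence of one-sample stochastic Frank-Wolfe *)

Theorem theorem1 (R : realType) (n : nat)
    (dZ : measure_display) (Z : measurableType dZ) (mu : {measure set Z -> \bar R})
    (F : 'cV[R]_n -> R) (Ft : 'cV[R]_n -> Z -> R) (p : Z -> 'cV[R]_n -> R)
    (K : set 'cV[R]_n) (D B G_F G_p L_F L_p : R) (xs : 'cV[R]_n)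
    (dO : measure_display) (Omega : measurableType dO) (P : probability Omega R)
    (a : nat -> Omega -> R) (z : nat -> Omega -> Z)
    (x dir v : nat -> Omega -> 'cV[R]_n) (x1 : 'cV[R]_n) (T : nat)
    (hpb : nonoblivious_problem mu F Ft p K)
    (hK0 : K !=set0) (hKconv : convex_set K) (hKcomp : compact K)
    (hD : is_diameter K D)
    (hB : forall y c, K y -> `|Ft y c| <= B)
    (hGp0 : 0 <= G_p) (hLp0 : 0 <= L_p)
    (hGF : forall y c, K y -> enorm (grad_Ft Ft y c) <= G_F)
    (hGp : forall y, K y ->
       (Ep mu p y (fun c => enorm (grad_logp p y c) ^+ 4)%R <= (G_p ^+ 4)%:E)%E)
    (hLF : forall y c, K y -> spnorm (hess_Ft Ft y c) <= L_F)
    (hLp : forall y, K y ->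
       (Ep mu p y (fun c => spnorm (hess_logp p y c) ^+ 2)%R <= (L_p ^+ 2)%:E)%E)
    (hFconv : convex_function K F)
    (hxs : K xs) (hmin : forall y, K y -> F xs <= F y)
    (hx1 : K x1) (hT : (1 <= T)%N)
    (hrun : one_sfw_run mu Ft p P a z x dir v K x1 T
              (fun t => (t.-1%:R)^-1) (fun t => (t%:R)^-1)) :
  let G : R := Num.max G_F G_p in
  let L : R := Num.max L_F L_p in
  let Lbar : R := Num.sqrt (4 * B ^+ 2 * G ^+ 4 + 16 * G ^+ 4
                        + 4 * L ^+ 2 + 4 * B ^+ 2 * L ^+ 2) in
  let C : R := Num.max (Num.max (4 * (2 * G + D * Lbar) ^+ 2) 256)
                   ((2 * D * (Lbar + L)) ^+ 4) in
  (forall w, K (x T.+1 w)) /\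
  ('E_P[fun w => (F (x T.+1 w) - F xs)%R] <=
     (2 * Num.sqrt C * D / Num.sqrt T%:R
      + Lbar * D ^+ 2 * (1 + ln T%:R) / (2 * T%:R))%:E)%E.
Proof.
move=> G L Lbar' C.
have G0 : 0 <= G by rewrite le_max hGp0 orbT.
have L0 : 0 <= L by rewrite le_max hLp0 orbT.
have [[y [y' [_ _ DE]]] hDle] := hD.
have D0 : 0 <= D by rewrite DE enorm_ge0.
have hGF' y0 c : K y0 -> enorm (grad_Ft Ft y0 c) <= G.
  by move=> Ky; rewrite le_max hGF.
have hLF' y0 c : K y0 -> spnorm (hess_Ft Ft y0 c) <= L.
  by move=> Ky; rewrite le_max hLF.
have hGp' y0 : K y0 ->
    (Ep mu p y0 (fun c => enorm (grad_logp p y0 c) ^+ 4)%R <= (G ^+ 4)%:E)%E.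
  move=> Ky; apply: (le_trans (hGp _ Ky)).
  by rewrite lee_fin ler_pXn2r ?nnegrE // le_max lexx orbT.
have hLp' y0 : K y0 ->
    (Ep mu p y0 (fun c => spnorm (hess_logp p y0 c) ^+ 2)%R <= (L ^+ 2)%:E)%E.
  move=> Ky; apply: (le_trans (hLp _ Ky)).
  by rewrite lee_fin ler_pXn2r ?nnegrE // le_max lexx orbT.
have C1 : 4 * (2 * G + D * Lbar') ^+ 2 <= C by rewrite 2!le_max lexx.
have C2 : 256 <= C by rewrite 2!le_max lexx orbT.
have C3 : (2 * D * (Lbar' + L)) ^+ 4 <= C by rewrite le_max lexx orbT.
split=> [w|]; first by apply: (iterate_in_K hKconv hx1 hrun); rewrite leqnn.
rewrite unlock.
exact: (expected_gap hpb hKconv hDle G0 L0 D0 hB hGF' hGp' hLF' hLp' hx1 hrun C1 C2 C3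
  hxs hmin hFconv hT).
Qed.
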